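(* Let $\beta>0$ and $h\in\mathbb{R}$ and assume that $h\neq0$ or $0<\beta<1$. Let $(k(N))_{N\in\mathbb{N}}$ be a sequence of positive integers with $k(N)\le N$, $\lim_{N\to\infty}k(N)=+\infty$ and $\lim_{N\to\infty}k(N)/N=\alpha$ for some $\alpha\in[0,1]$. Then $$\lim_{N\to\infty}d_{TV}\left(\mu_N\circ\mathcal{P}_{k(N)}^{-1},\ \mathrm{Bin}\left(k(N),\mathrm{Beta}(\gamma_1(\beta,h)N,\gamma_2(\beta,h)N)\right)\right)=0,$$ where, with $m=m(\beta,h)$, $$\gamma_1(\beta,h)=\frac{1-\beta(1-m^2)}{2\beta(1-m)},\qquad \gamma_2(\beta,h)=\frac{1-\beta(1-m^2)}{2\beta(1+m)}.$$
   Context: For $\beta>0$, $h\in\mathbb{R}$ and $N\in\mathbb{N}$, the Curie-Weiss Gibbs measure $\mu_N=\mu_{N,\beta,h}$ is the probability measure on $\{-1,+1\}^N$ given by $$\mu_N(\sigma)=\frac{1}{Z_N}\exp\left(\frac{\beta}{2N}\sum_{i,j=1}^N\sigma_i\sigma_j+h\sum_{i=1}^N\sigma_i\right),$$ where $Z_N$ is the normalizing constant. For $1\le k\le N$, $\mathcal{P}_k=\mathcal{P}_k(\sigma)=|\{j\in\{1,\dots,k\}:\sigma_j=+1\}|$, and $\mu_N\circ\mathcal{P}_k^{-1}$ is its distribution under $\mu_N$. $m(\beta,h)$ denotes the solution $z$ of $z=\tanh(\beta z+h)$ that is largest in absolute value: for the parameters considered here it is unique and positive if $h>0$, unique and negative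 if $h<0$, and equal to $0$ if $h=0$ and $0<\beta<1$. One has $|m(\beta,h)|<1$ and $0<\beta(1-m(\beta,h)^2)<1$. For $a,b>0$, $\mathrm{Beta}(a,b)$ is the beta distribution on $(0,1)$ with density $x^{a-1}(1-x)^{b-1}/B(a,b)$, $B$ being the Euler beta function. For a probability distribution $\nu$ on $[0,1]$, $\mathrm{Bin}(n,\nu)$ is the mixed binomial distribution $\mathrm{Bin}(n,\nu)(\{j\})=\int_{[0,1]}\binom nj x^j(1-x)^{n-j}\,\nu(dx)$, $0\le j\le n$. The total variation distance is $d_{TV}(\mathfrak{M}_1,\mathfrak{M}_2)=\sup_{A\in\mathcal{B}(\mathbb{R})}|\mathfrak{M}_1(A)-\mathfrak{M}_2(A)|$. *)

(* Defs.v *)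
From HB Require Import structures.
From mathcomp Require Import all_boot all_order all_algebra.
From mathcomp Require Import all_classical all_reals all_analysis.
From mathcomp Require Import measurable_realfun.

Set Implicit Arguments.
Unset Strict Implicit.
Unset Printing Implicit Defensive.

Import Order.TTheory GRing.Theory Num.Theory.
Import numFieldNormedType.Exports.

Local Open Scope classical_set_scope.
Local Open Scope ring_scope.

(* {-1,+1}^N is represented by boolean vectors; [spin] is the bijection of
   bool with {-1,+1}. Every set of configurations is measurable. *)
Definition config (N : nat) : Type := {ffun 'I_N -> bool}.

HB.instance Definition _ N := Finite.on (config N).
HB.instance Definition _ N := isPointed.Build (config N) [ffun=> true].
HB.instance Definition _ N := @isMeasurable.Build default_measure_display
  (config N) discrete_measurable discrete_measurable0
  discrete_measurableC discrete_measurableU.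

Definition spin (R : realType) (b : bool) : R := if b then 1 else -1.

Section weighted_dirac.
Local Open Scope ereal_scope.
Context d (T : measurableType d) (R : realType) (I : finType).
Variables (x : I -> T) (w : I -> \bar R).

Lemma weighted_dirac0 : \sum_(i : I) w i * \d_(x i) set0 = 0.
Proof. by apply: big1 => i _; rewrite measure0 mule0. Qed.

Hypothesis w0 : forall i, 0 <= w i.

Lemma weighted_dirac_ge0 A : 0 <= \sum_(i : I) w i * \d_(x i) A.
Proof. by apply: sume_ge0 => i _; exact: mule_ge0. Qed.

Lemma weighted_dirac_sigma_additive :
  semi_sigma_additive (fun A => \sum_(i : I) w i * \d_(x i) A).
Proof.
move=> F mF tF mUF.
rewrite (_ : (fun n => _) =
    (fun n => \sum_i \sum_(0 <= j < n) w i * \d_(x i) (F j))); last first.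
  by apply/funext => n; rewrite exchange_big.
have E i A : measurable A -> w i * \d_(x i) A = \int[\d_(x i)]_(y in A) w i.
  by move=> mA; rewrite integral_cst.
apply: cvg_nnesum => [i _|i _].
  by apply: nearW => n; apply: sume_ge0 => j _; exact: mule_ge0.
rewrite E// ge0_integral_bigcup//.
rewrite (eq_eseriesr (g := fun j => w i * \d_(x i) (F j))); last first.
  by move=> j _; rewrite E.
by apply: is_cvg_nneseries => j _ _; exact: mule_ge0.
Qed.

End weighted_dirac.
Arguments weighted_dirac_sigma_additive {d T R I} x {w} w0.

Section curie_weiss.
Context {R : realType} (N : nat) (beta h : R).

Definition cw_weight (s : config N) : R :=
  expR (beta / (2 * N%:R) * (\sum_(i < N) \sum_(j < N) spin R (s i) * spin R (s j))
        + h * \sum_(i < N) spin R (s i)).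

Definition cw_partition : R := \sum_(s : config N) cw_weight s.

Definition curie_weiss (A : set (config N)) : \bar R :=
  (\sum_(s : config N) (cw_weight s / cw_partition)%:E * \d_s A)%E.

Lemma cw_partition_gt0 : 0 < cw_partition.
Proof.
rewrite /cw_partition (bigD1 ([ffun=> true] : config N))//= ltr_pwDl ?expR_gt0//.
by apply: sumr_ge0 => s _; exact: expR_ge0.
Qed.

Let cw0 s : (0 <= (cw_weight s / cw_partition)%:E)%E.
Proof. by rewrite lee_fin divr_ge0 ?expR_ge0// ltW// cw_partition_gt0. Qed.

Let curie_weiss0 : curie_weiss set0 = 0%E.
Proof. exact: (weighted_dirac0 (fun s : config N => s)). Qed.

Let curie_weiss_ge0 A : (0 <= curie_weiss A)%E.
Proof. exact: (weighted_dirac_ge0 (fun s : config N => s) cw0). Qed.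

Let curie_weiss_sigma_additive : semi_sigma_additive curie_weiss.
Proof.
exact: (weighted_dirac_sigma_additive (fun s : config N => s) cw0).
Qed.

HB.instance Definition _ := isMeasure.Build _ _ _ curie_weiss
  curie_weiss0 curie_weiss_ge0 curie_weiss_sigma_additive.

Let curie_weiss_setT : curie_weiss [set: config N] = 1%E.
Proof.
rewrite /curie_weiss; under eq_bigr do rewrite diracT mule1.
by rewrite sumEFin -mulr_suml divff// gt_eqF// cw_partition_gt0.
Qed.

HB.instance Definition _ :=
  @Measure_isProbability.Build _ _ _ curie_weiss curie_weiss_setT.

End curie_weiss.
Arguments curie_weiss {R} N beta h.

(* Sites are numbered from 0, so {1, ..., k} becomes {j | j < k}. *)
Definition plus_count (R : realType) (N k : nat) (s : config N) : R :=
  #|[set j : 'I_N | (j < k)%N && s j]%SET|%:R.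

Lemma measurable_plus_count (R : realType) (N k : nat) :
  measurable_fun [set: config N] (@plus_count R N k).
Proof. by move=> _ A _. Qed.

HB.instance Definition _ (R : realType) (N k : nat) :=
  @isMeasurableFun.Build _ _ (config N) R (@plus_count R N k)
    (@measurable_plus_count R N k).

Definition tanh {R : realType} (x : R) : R :=
  (expR x - expR (- x)) / (expR x + expR (- x)).

(* [xget 0] selects an element of the given set, and is 0 if the set is empty.
   For h != 0 or 0 < beta < 1, the set below is a singleton. *)
Definition magnetization {R : realType} (beta h : R) : R :=
  xget 0 [set z | z = tanh (beta * z + h) /\
                  forall z', z' = tanh (beta * z' + h) -> `|z'| <= `|z|].

Definition gamma1 {R : realType} (beta h : R) : R :=
  let m := magnetization beta h in
  (1 - beta * (1 - m ^+ 2)) / (2 * beta * (1 - m)).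

Definition gamma2 {R : realType} (beta h : R) : R :=
  let m := magnetization beta h in
  (1 - beta * (1 - m ^+ 2)) / (2 * beta * (1 + m)).

(* The library's beta distribution only covers natural number parameters. *)
Section real_beta.
Context {R : realType} (a b : R).
Local Notation mu := (@lebesgue_measure R).

Definition rbeta_kernel (x : R) : R := x `^ (a - 1) * (1 - x) `^ (b - 1).

Definition rbeta_fun : R := (\int[mu]_(x in `]0, 1[) rbeta_kernel x)%R.

Definition rbeta_pdf (x : R) : R :=
  if x \in `]0, 1[ then rbeta_kernel x / rbeta_fun else 0.

Definition rbeta_prob (A : set R) : \bar R :=
  (\int[mu]_(x in A) (rbeta_pdf x)%:E)%E.

Lemma rbeta_pdf_ge0 x : 0 <= rbeta_pdf x.
Proof.
rewrite /rbeta_pdf; case: ifPn => // _.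
rewrite divr_ge0 ?mulr_ge0 ?powR_ge0//.
by apply: Rintegral_ge0 => y _; rewrite mulr_ge0 ?powR_ge0.
Qed.

Lemma measurable_rbeta_pdf : measurable_fun [set: R] rbeta_pdf.
Proof.
rewrite (_ : rbeta_pdf = (fun x => rbeta_kernel x / rbeta_fun) \_ `]0, 1[).
  apply/measurable_restrict => //; rewrite setTI.
  apply: measurable_funTS; apply: measurable_funM => //.
  apply: measurable_funM; first exact: measurable_powR.
  have mB : measurable_fun [set: R] (fun x : R => 1 - x).
    exact: measurable_funB.
  exact: (measurableT_comp (measurable_powR (b - 1)) mB).
by apply/funext => x; rewrite patchE /rbeta_pdf mem_setE.
Qed.

Let rbeta0 : rbeta_prob set0 = 0%E.
Proof. exact: integral_set0. Qed.

Let rbeta_ge0 A : (0 <= rbeta_prob A)%E.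
Proof. by apply: integral_ge0 => x _; rewrite lee_fin rbeta_pdf_ge0. Qed.

Let rbeta_sigma_additive : semi_sigma_additive rbeta_prob.
Proof.
move=> /= F mF tF mUF; rewrite /rbeta_prob ge0_integral_bigcup//=.
- apply: is_cvg_nneseries => n _ _; exact: rbeta_ge0.
- apply/measurable_funTS/measurableT_comp => //; exact: measurable_rbeta_pdf.
- by move=> x _; rewrite lee_fin rbeta_pdf_ge0.
Qed.

HB.instance Definition _ := isMeasure.Build _ _ _ rbeta_prob
  rbeta0 rbeta_ge0 rbeta_sigma_additive.

End real_beta.

Section mixed_binomial.
Context {R : realType} (n : nat).
Variable nu : {measure set R -> \bar R}.

Definition mixed_binomial_pmf (j : nat) : \bar R :=
  (\int[nu]_(x in `[0%R, 1%R]) (binomial_pmf n x j)%:E)%E.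

Definition mixed_binomial (A : set R) : \bar R :=
  (\sum_(j < n.+1) mixed_binomial_pmf j * \d_(j%:R : R) A)%E.

Let pmf0 (j : 'I_n.+1) : (0 <= mixed_binomial_pmf j)%E.
Proof.
apply: integral_ge0 => x /=; rewrite in_itv/= => x01.
by rewrite lee_fin binomial_pmf_ge0.
Qed.

Let point_of (j : 'I_n.+1) : R := j%:R.

Let mixed_binomial0 : mixed_binomial set0 = 0%E.
Proof. exact: (weighted_dirac0 point_of). Qed.

Let mixed_binomial_ge0 A : (0 <= mixed_binomial A)%E.
Proof. exact: (weighted_dirac_ge0 point_of pmf0). Qed.

Let mixed_binomial_sigma_additive : semi_sigma_additive mixed_binomial.
Proof. exact: (weighted_dirac_sigma_additive point_of pmf0). Qed.

HB.instance Definition _ := isMeasure.Build _ _ _ mixed_binomial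
  mixed_binomial0 mixed_binomial_ge0 mixed_binomial_sigma_additive.

End mixed_binomial.

Definition dTV {R : realType}
    (M1 M2 : {measure set R -> \bar R}) : \bar R :=
  ereal_sup [set `|M1 A - M2 A|%E | A in measurable].

(* Main.v *)
Require Import Defs.
From HB Require Import structures.
From mathcomp Require Import all_boot all_order all_algebra.
From mathcomp Require Import all_classical all_reals all_analysis.
From mathcomp Require Import measurable_realfun.
From mathcomp Require Import ring lra.
Import Order.TTheory GRing.Theory Num.Theory.
Import numFieldNormedType.Exports.
Set Implicit Arguments.
Unset Strict Implicit.
Unset Printing Implicit Defensive.
Local Open Scope classical_set_scope.
Local Open Scope ring_scope.

(** Why the theorem holds.

The Gibbs measure is exchangeable, and the mixed binomial distribution is the law
of the number of pluses among the first k of N spins that are independent given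
a random success probability with a beta distribution. Both distributions are thus
images of exchangeable laws on N spins under the same map, and their distance is
at most the l1 distance of the laws p and q of the total number of pluses
([dTV_le_counts]). This reduces the theorem to the case k = N, that is, to
comparing the Curie-Weiss law p with the beta-binomial law q on {0, ..., N}.

Both laws live at distance O(sqrt N) from N (1 + m) / 2, in the sense that their
second moments about this point are O(N). This is a consequence of detailed
balance: each law is reversible for a birth-death chain whose drift it must make
small on average ([birth_death_second_moment]). For q the drift is affine. For p
it is, up to a bounded error, N (tanh (beta z + h) - z) / 2 at mean spin z, and
it remains to see that z is close to m when this is small. For beta < 1 the map
z |-> tanh (beta z + h) is a contraction. For h > 0 it is concave on the positive
half-line, which gives the same conclusion there, and negative values of z are
excluded by comparing with the flipped configurations
([cw_second_moment_contraction], [cw_second_moment_pos]).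

Inside a window around the centre the two laws are compared by the ratios
p(l+1) / p(l) and q(l+1) / q(l), which are explicit: the first from the Gibbs
weight, the second from the functional equation of the beta function
([rbeta_fun_rec]). At l = N (1 + m) / 2 + N y the quotient of these two ratios is
exp (O(y^2 + 1/N)): the constant term vanishes by the equation for m, and the
linear term by the choice of gamma1 and gamma2 ([cw_bb_step]). Over a window
of half-width n with N^(1/2) << n << N^(2/3) these errors add up to o(1), so p / q
is nearly constant on the window, and since both laws have almost all of their
mass there, the constant is nearly 1 ([l1_comparison]). With n = r^3 and N of
the order of r^5 all the errors are O(1/r) ([cw_bb_rate]). *)

(** * Integrals against a measure with a density *)

Section integral_density.
Local Open Scope ereal_scope.
Import HBNNSimple.

(** Both sides agree on indicators by the hypothesis on [nu], hence on simple
functions, and monotone convergence carries the identity to [f]. *)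
Lemma ge0_integral_density d (T : measurableType d) (R : realType)
    (mu nu : {measure set T -> \bar R}) (g : T -> R)
    (g0 : forall x, (0 <= g x)%R) (mg : measurable_fun [set: T] g)
    (nuE : forall A, measurable A -> nu A = \int[mu]_(x in A) (g x)%:E)
    (D : set T) (mD : measurable D) (f : T -> \bar R)
    (f0 : forall x, D x -> 0 <= f x) (mf : measurable_fun D f) :
  \int[nu]_(x in D) f x = \int[mu]_(x in D) (f x * (g x)%:E).
Proof.
have mgD : measurable_fun D (EFin \o g).
  by apply/measurable_funTS/measurableT_comp.
pose s := nnsfun_approx mD mf.
have ss x m n : (m <= n)%N -> (s m x <= s n x)%R.
  by move=> mn; exact/lefP/nd_nnsfun_approx.
have ms n : measurable_fun D (EFin \o s n).
  by apply/measurable_EFinP/measurable_funTS.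
transitivity (limn (fun n => \int[nu]_(x in D) (s n x)%:E)).
  rewrite -monotone_convergence//=.
  - apply: eq_integral => x /[!inE] Dx; apply/esym/cvg_lim => //.
    exact: cvg_nnsfun_approx.
  - by move=> n x _; rewrite lee_fin.
  - by move=> x _ m n mn; rewrite lee_fin; exact: ss.
transitivity (limn (fun n => \int[mu]_(x in D) ((s n x)%:E * (g x)%:E)));
    last first.
  rewrite -monotone_convergence//=.
  - apply: eq_integral => x /[!inE] Dx; apply/cvg_lim => //.
    by apply: cvgeZr => //; exact: cvg_nnsfun_approx.
  - by move=> n; apply: emeasurable_funM; [exact: ms|exact: mgD].
  - by move=> n x _; rewrite mule_ge0 ?lee_fin.
  - by move=> x _ m n mn; rewrite lee_wpmul2r ?lee_fin//; exact: ss.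
congr (limn _); apply/funext => n.
have mind r : measurable_fun D (fun x => (r * \1_(s n @^-1` [set r]) x)%:E).
  by apply/measurable_funTS/measurableT_comp => //; exact: measurable_funM.
under eq_integral do rewrite fimfunE -fsumEFin//.
under [RHS]eq_integral => x _.
  rewrite fimfunE -fsumEFin// ge0_mule_fsuml; last first.
    by move=> r; exact: nnfun_muleindic_ge0.
  over.
rewrite !ge0_integral_fsum//; first last.
- by move=> r x _; exact: nnfun_muleindic_ge0.
- move=> r x _; apply: mule_ge0; last by rewrite lee_fin.
  exact: nnfun_muleindic_ge0.
- by move=> r; apply: emeasurable_funM; [exact: mind|exact: mgD].
apply: eq_fsbigr => r; rewrite inE => -[t _ <-]; set y := s n t.
rewrite integralZl_indic_nnsfun// integral_indic//.
under [RHS]eq_integral do rewrite EFinM -muleA.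
rewrite ge0_integralZl//; last 3 first.
- apply: emeasurable_funM => //; exact/measurable_EFinP/measurable_funTS.
- by move=> x _; rewrite mule_ge0 ?lee_fin.
- by rewrite lee_fin.
congr (_ * _); rewrite nuE; last exact: measurableI.
rewrite setIC integral_mkcondr; apply: eq_integral => x _.
by rewrite patchE /= indicE; case: ifPn => _; rewrite ?mul1e ?mul0e.
Qed.
End integral_density.

(** * Euler's beta integral with real parameters *)

Section beta_function.
Context {R : realType}.
Local Notation mu := (@lebesgue_measure R).

(** The absolute value gives one function that is continuous on the whole line
and agrees with the power on the positive half-line, so that continuity on
[[0, 1]] needs no case distinction at the endpoints. *)
Lemma continuous_norm_powR (c : R) : 0 < c ->
  continuous (fun x : R => `|x| `^ c).
Proof.
move=> c0.
suff H0 (x : R) : {for x, continuous (fun x : R => `|x| `^ c)} by exact: H0.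
have [->|x0] := eqVneq x 0.
  apply/cvgrPdist_lt => e e0; rewrite normr0 powR0 ?gt_eqF//.
  have [d /= d0 Hd] : \forall d \near 0^'+, `|0 - d `^ c| < e.
    by have /cvgrPdist_lt := powR_cvg0 c0; apply.
  apply/nbhs_normP; exists d => //= y; rewrite /ball_/= sub0r normrN => yd.
  have [->|y0] := eqVneq y 0.
    by rewrite /= normr0 powR0 ?gt_eqF// ?subr0 normr0.
  have := Hd `|y|; rewrite /= ?sub0r !normrN normr_id normr_gt0 => /(_ yd y0) H; exact: H.
change {for x, continuous ((fun y : R => y `^ c) \o (fun y : R => `|y|))}.
apply: continuous_comp.
  exact: norm_continuous.
apply/differentiable_continuous/derivable1_diffP.
by apply: derivable_powR; rewrite in_itv/= andbT normr_gt0.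
Qed.

(* Replaces the beta kernel on ]0, 1[; unlike the kernel it is continuous on the
   whole line as soon as both exponents are positive. *)
Let G (a b x : R) : R := `|x| `^ a * `|1 - x| `^ b.

Let cG (a b : R) : 0 < a -> 0 < b -> continuous (G a b).
Proof.
move=> a0 b0.
suff H (x : R) : {for x, continuous (G a b)} by exact: H.
apply: cvgM; first exact: continuous_norm_powR.
apply: (@continuous_comp _ _ _ (fun y : R => 1 - y) (fun y => `|y| `^ b)).
  by apply: cvgB; [exact: cvg_cst|exact: cvg_id].
exact: continuous_norm_powR.
Qed.

Let iC (f : R -> R) : continuous f -> mu.-integrable `[0%R, 1%R] (EFin \o f).
Proof.
move=> cf; apply: continuous_compact_integrable; first exact: segment_compact.
exact: continuous_subspaceT.
Qed.

Let iG (a b : R) : 0 < a -> 0 < b -> mu.-integrable `[0%R, 1%R] (EFin \o G a b).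
Proof. by move=> a0 b0; apply: iC; exact: cG. Qed.

Let GE (a b x : R) : x \in `]0, 1[ -> rbeta_kernel a b x = G (a - 1) (b - 1) x.
Proof.
rewrite in_itv/= => /andP[x0 x1].
by rewrite /rbeta_kernel /G !gtr0_norm ?subr_gt0.
Qed.

Let rbeta_funE (a b : R) : 1 < a -> 1 < b ->
  rbeta_fun a b = \int[mu]_(x in `[0, 1]) G (a - 1) (b - 1) x.
Proof.
move=> a1 b1; have iG1 := @iG (a - 1) (b - 1).
transitivity (\int[mu]_(x in `]0%R, 1%R[) G (a - 1) (b - 1) x).
  by apply: eq_Rintegral => x /[!inE] /GE.
rewrite Rintegral_itv_bndo_bndc ?Rintegral_itv_obnd_cbnd//.
  apply: integrableS (iG1 _ _) => //; rewrite ?subr_gt0//.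
  exact: subset_itv_oc_cc.
apply: integrableS (iG1 _ _) => //; rewrite ?subr_gt0//.
exact: subset_itv_oo_cc.
Qed.

Lemma integrable_rbeta_kernel (a b : R) : 1 < a -> 1 < b ->
  mu.-integrable `]0%R, 1%R[ (EFin \o rbeta_kernel a b).
Proof.
move=> a1 b1.
have : mu.-integrable `]0%R, 1%R[ (EFin \o G (a - 1) (b - 1)).
  by apply: integrableS (iG _ _) => //;
    [exact: subset_itv_oo_cc|rewrite subr_gt0..].
apply: eq_integrable => // x /[!inE] xI.
by rewrite /= GE.
Qed.

Lemma rbeta_kernel_gt0 (a b x : R) : x \in `]0, 1[ -> 0 < rbeta_kernel a b x.
Proof.
rewrite in_itv/= => /andP[x0 x1].
by rewrite mulr_gt0// powR_gt0// subr_gt0.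
Qed.

(** A zero integral would make the kernel vanish almost everywhere on an
interval of length 1, where it is positive. *)
Lemma rbeta_fun_gt0 (a b : R) : 1 < a -> 1 < b -> 0 < rbeta_fun a b.
Proof.
move=> a1 b1; have iK := integrable_rbeta_kernel a1 b1.
rewrite /rbeta_fun lt_neqAle Rintegral_ge0 ?andbT; last first.
  by move=> x /= x01; rewrite ltW// rbeta_kernel_gt0.
apply/eqP => /esym K0.
have : (\int[mu]_(x in `]0%R, 1%R[) `|(rbeta_kernel a b x)%:E| = 0)%E.
  under eq_integral => x /[!inE] x01.
    rewrite gee0_abs; last by rewrite lee_fin ltW// rbeta_kernel_gt0.
    over.
  rewrite -[LHS]fineK; last exact: integrable_fin_num.
  by rewrite -[X in X%:E]/(rbeta_fun a b) /rbeta_fun K0.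
move/ae_eq_integral_abs => H.
have [//||A [mA A0 sA]] := H; first exact: measurable_int iK.
have : (mu `]0%R, 1%R[ <= mu A)%E.
  apply: le_measure; rewrite ?inE// => x x01.
  apply: sA => /= /(_ x01) [] /eqP; rewrite gt_eqF//.
  exact: rbeta_kernel_gt0.
by rewrite A0 lebesgue_measure_itv/= lte_fin ltr01 oppr0 adde0 lee_fin ler10.
Qed.

(** The function x^a (1 - x)^b vanishes at both ends of [[0, 1]], so its
derivative a x^(a-1) (1 - x)^b - b x^a (1 - x)^(b-1) integrates to 0. This
recursion is all that the comparison needs to know about the beta function:
no asymptotic formula for it is used. *)
Lemma rbeta_fun_rec (a b : R) : 1 < a -> 1 < b ->
  b * rbeta_fun (a + 1) b = a * rbeta_fun a (b + 1).
Proof.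
move=> a1 b1.
have a0 : 0 < a by lra.
have b0 : 0 < b by lra.
pose F := G a b.
pose f x := a * G (a - 1) b x - b * G a (b - 1) x.
have cf : continuous f.
  move=> x; apply: cvgB; apply: cvgM; (try exact: cvg_cst);
  by apply: cG; lra.
have dF (x : R) : x \in `]0, 1[ -> is_derive x 1 F (f x).
  rewrite in_itv/= => /andP[x0 x1].
  have y0 : 0 < 1 - x by rewrite subr_gt0.
  apply: (@near_eq_is_derive _ _ _ (fun y => y `^ a * (1 - y) `^ b)).
    near=> y; rewrite /F /G !gtr0_norm// ?subr_gt0; near: y.
      exact: lt_nbhsl.
    exact: lt_nbhsr.
  have H1 : is_derive x 1 ((fun y : R => y `^ b) \o (fun y : R => 1 - y))
      (b * (1 - x) `^ (b - 1) * (0 - 1)).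
    by apply: is_derive1_comp; exact: is_derive1_powR.
  have H2 : is_derive x 1 (fun y => y `^ a : R) (a * x `^ (a - 1)).
    exact: is_derive1_powR.
  have H3 := is_deriveM H2 H1.
  apply: is_derive_eq H3 _.
  rewrite /f /G !gtr0_norm// /GRing.scale/=; ring.
have dFLR : derivable_oo_LRcontinuous F 0 1.
  split; first by move=> x /dF [].
    by apply: cvg_at_right_filter; exact: cG.
  by apply: cvg_at_left_filter; exact: cG.
have FE : {in `]0, 1[, derive1 F =1 f}.
  by move=> x /dF Fx; rewrite derive1E; exact: derive_val.
have := continuous_FTC2 ltr01 (continuous_subspaceT cf) dFLR FE.
have -> : F 1 = 0 by rewrite /F /G subrr normr0 powR0 ?gt_eqF// mulr0.
have -> : F 0 = 0 by rewrite /F /G normr0 powR0 ?gt_eqF// mul0r.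
rewrite sube0 => f0.
have {f0} : \int[mu]_(x in `[0, 1]) f x = 0 by rewrite /Rintegral f0.
have i1 : mu.-integrable `[0%R, 1%R] (EFin \o G (a - 1) b) by apply: iG; lra.
have i2 : mu.-integrable `[0%R, 1%R] (EFin \o G a (b - 1)) by apply: iG; lra.
rewrite RintegralB; [|by []| |].
- rewrite (RintegralZl _ _ i1); last by [].
  rewrite (RintegralZl _ _ i2); last by [].
  rewrite rbeta_funE; [|lra|by []].
  rewrite rbeta_funE; [|by []|lra].
  rewrite !addrK; set u := Rintegral _ _ _; set v := Rintegral _ _ _.
  by clearbody u v; clear; move=> H; lra.
- by apply: iC => x; apply: cvgM; [exact: cvg_cst|apply: cG; lra].
- by apply: iC => x; apply: cvgM; [exact: cvg_cst|apply: cG; lra].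
Unshelve. all: by end_near. Qed.
End beta_function.

(** * Moments of the beta distribution *)

Section beta_moments.
Context {R : realType}.
Local Notation mu := (@lebesgue_measure R).

(** The beta distribution and Lebesgue measure live on two measurable structures
of the line that have the same measurable sets but different displays; pushing
Lebesgue measure forward along the identity moves it from one to the other. *)
Lemma integral_rbeta_prob (a b : R) (D : set R) (f : R -> \bar R) :
  measurable D -> (forall x, D x -> 0 <= f x)%E -> measurable_fun D f ->
  (\int[rbeta_prob a b]_(x in D) f x =
   \int[mu]_(x in D) (f x * (rbeta_pdf a b x)%:E))%E.
Proof.
move=> mD f0 mf.
pose phi : measurableTypeR R -> R := fun x => x.
have mphi : measurable_fun [set: _] phi by move=> _ A mA; rewrite setTI.
pose mphi' : {mfun _ >-> _} := HB.pack phi (isMeasurableFun.Build _ _ _ _ phi mphi).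
pose mu' := pushforward mu mphi'.
have mpdf := measurable_rbeta_pdf a b.
have mu'E E (g : R -> \bar R) : measurable E -> measurable_fun E g ->
    (forall x, E x -> 0 <= g x)%E -> (\int[mu']_(x in E) g x = \int[mu]_(x in E) g x)%E.
  move=> mE mg g0; rewrite ge0_integral_pushforward//.
  by move=> x /[!inE]; exact: g0.
rewrite (@ge0_integral_density _ _ _ mu' _ (rbeta_pdf a b))//.
- rewrite mu'E//.
  + apply: emeasurable_funM => //; exact/measurable_EFinP/measurable_funTS.
  + by move=> x Dx; rewrite mule_ge0 ?lee_fin ?rbeta_pdf_ge0 ?f0.
- exact: rbeta_pdf_ge0.
- move=> A mA; rewrite mu'E//.
  + exact/measurable_EFinP/measurable_funTS.
  + by move=> x _; rewrite lee_fin rbeta_pdf_ge0.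
Qed.

(** Multiplying the density by x^l (1 - x)^m shifts the two parameters of the
beta distribution by [l] and [m]. *)
Lemma rbeta_moment (a b : R) (l m : nat) : 1 < a -> 1 < b ->
  (\int[rbeta_prob a b]_(x in `[0%R, 1%R]) (x ^+ l * (1 - x) ^+ m)%:E =
   (rbeta_fun (a + l%:R) (b + m%:R) / rbeta_fun a b)%:E)%E.
Proof.
move=> a1 b1.
have al1 : 1 < a + l%:R by rewrite (lt_le_trans a1)// lerDl.
have bm1 : 1 < b + m%:R by rewrite (lt_le_trans b1)// lerDl.
transitivity (\int[mu]_(x in `[0%R, 1%R])
    ((x ^+ l * (1 - x) ^+ m)%:E * (rbeta_pdf a b x)%:E))%E.
  apply: integral_rbeta_prob => //.
    move=> x /=; rewrite in_itv/= => /andP[x0 x1].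
    by rewrite lee_fin mulr_ge0 ?exprn_ge0// subr_ge0.
  apply/measurable_EFinP/measurable_funTS; apply: measurable_funM.
    exact: measurable_funX.
  by apply: measurable_funX; exact: measurable_funB.
transitivity (\int[mu]_(x in `[0%R, 1%R] `&` `]0%R, 1%R[)
    (rbeta_kernel (a + l%:R) (b + m%:R) x * (rbeta_fun a b)^-1)%:E)%E.
  rewrite integral_mkcondr; apply: eq_integral => x _.
  rewrite patchE /rbeta_pdf mem_setE -EFinM; case: ifPn => [|_]; last first.
    by rewrite mulr0.
  rewrite in_itv/= => /andP[x0 x1]; congr EFin.
  have y0 : 0 < 1 - x by rewrite subr_gt0.
  rewrite /rbeta_kernel [a + l%:R]addrC [b + m%:R]addrC -!addrA.
  rewrite (@powRD _ x l%:R) ?(gt_eqF x0) ?implybT//.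
  rewrite (@powRD _ (1 - x) m%:R) ?(gt_eqF y0) ?implybT//.
  by rewrite !powR_mulrn ?ltW//; ring.
have -> : `[0%R, 1%R] `&` `]0%R, 1%R[ = `]0%R, 1%R[%classic :> set R.
  by rewrite setIidr//; exact: subset_itv_oo_cc.
have iK := integrable_rbeta_kernel al1 bm1.
under eq_integral do rewrite EFinM.
rewrite integralZr//= EFinM; congr (_ * _)%E.
by rewrite /rbeta_fun /Rintegral fineK//; exact: integrable_fin_num.
Qed.

(** The mixed binomial weights sum to 1: the binomial formula under the
integral. *)
Lemma rbeta_binomial_sum (a b : R) (n : nat) : 1 < a -> 1 < b ->
  \sum_(l < n.+1) 'C(n, l)%:R *
    (rbeta_fun (a + l%:R) (b + (n - l)%:R) / rbeta_fun a b) = 1.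
Proof.
move=> a1 b1; apply: EFin_inj.
have -> : 1%:E = (\int[rbeta_prob a b]_(x in `[0%R, 1%R]) 1%:E)%E.
  have := rbeta_moment 0 0 a1 b1; rewrite !addr0 divff; last first.
    by rewrite gt_eqF// rbeta_fun_gt0.
  by under eq_integral do rewrite !expr0 mulr1.
rewrite -sumEFin.
transitivity (\sum_(l < n.+1) \int[rbeta_prob a b]_(x in `[0%R, 1%R])
    ('C(n, l)%:R * (x ^+ l * (1 - x) ^+ (n - l)))%:E)%E.
  apply: eq_bigr => l _; rewrite EFinM -rbeta_moment//.
  rewrite -ge0_integralZl//=.
  - apply/measurable_EFinP/measurable_funTS; apply: measurable_funM.
      exact: measurable_funX.
    by apply: measurable_funX; exact: measurable_funB.
  - move=> x /=; rewrite in_itv/= => /andP[x0 x1].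
    by rewrite lee_fin mulr_ge0 ?exprn_ge0// subr_ge0.
rewrite -ge0_integral_sum//=.
- apply: eq_integral => x _; rewrite sumEFin; congr EFin.
  transitivity ((1 - x + x) ^+ n); last by rewrite subrK expr1n.
  rewrite exprDn; apply: eq_bigr => l _.
  by rewrite mulr_natl [x ^+ l * _]mulrC.
- move=> l; apply/measurable_EFinP/measurable_funTS; apply: measurable_funM => //.
  apply: measurable_funM; first exact: measurable_funX.
  by apply: measurable_funX; exact: measurable_funB.
- move=> l x /=; rewrite in_itv/= => /andP[x0 x1].
  by rewrite lee_fin !mulr_ge0 ?exprn_ge0// subr_ge0.
Qed.

End beta_moments.

(** * Configurations and their numbers of pluses *)

Section configurations.
Variable N : nat.

Definition pluses (s : config N) : nat := #|[set j : 'I_N | s j]%SET|.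

Definition pluses_below (k : nat) (s : config N) : nat :=
  #|[set j : 'I_N | (j < k)%N && s j]%SET|.

Lemma pluses_below_le k (s : config N) : (k <= N)%N -> (pluses_below k s <= k)%N.
Proof.
move=> kN; apply: (@leq_trans #|[set j : 'I_N | (j < k)%N]%SET|).
  by apply/subset_leq_card/fintype.subsetP => j; rewrite !inE => /andP[].
rewrite -sum1_card (eq_bigl (fun j : 'I_N => (j < k)%N)); last first.
  by move=> j; rewrite inE.
by rewrite -(big_ord_widen _ (fun=> 1%N))// sum1_card card_ord.
Qed.

(** A configuration is determined by the set of its pluses, and 'C(N, l) of
these sets have [l] elements. *)
Lemma sum_pluses (V : zmodType) (F : nat -> V) :
  \sum_(s : config N) F (pluses s) = \sum_(l < N.+1) F l *+ 'C(N, l).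
Proof.
pose c (A : {set 'I_N}) : config N := [ffun i => i \in A].
have cE A : [set j | c A j]%SET = A.
  by apply/setP => j; rewrite inE ffunE.
have bc : {on predT, bijective c}.
  exists (fun s : config N => [set j | s j]%SET) => [A _|s _]; first exact: cE.
  by apply/ffunP => j; rewrite ffunE inE.
rewrite (reindex c)//=; under eq_bigr do rewrite /pluses cE.
rewrite (partition_big (fun A : {set 'I_N} => inord #|A| : 'I_N.+1) predT)//=.
apply: eq_bigr => l _; rewrite (eq_bigr (fun=> F l)); last first.
  move=> A /eqP <-; rewrite inordK// ltnS -[leqRHS]card_ord max_card//.
rewrite sumr_const -[N in 'C(N, _)]card_ord -card_draws.
congr (_ *+ _); apply: eq_card => A; rewrite unfold_in/= !inE. rewrite inordK//.
by rewrite ltnS -[leqRHS]card_ord max_card.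
Qed.

Lemma prod_pluses (R : comRingType) (x y : R) (s : config N) :
  \prod_i (if s i then x else y) = x ^+ pluses s * y ^+ (N - pluses s).
Proof.
rewrite (bigID (fun i => s i))/=; congr (_ * _).
  under eq_bigr => i -> do [].
  by rewrite prodr_const; congr (_ ^+ _); apply: eq_card => i; rewrite !inE.
under eq_bigr => i /negbTE -> do [].
rewrite prodr_const; congr (_ ^+ _).
have -> : (N - pluses s)%N = #|~: [set j | s j]%SET|.
  by rewrite cardsCs finset.setCK card_ord.
by apply: eq_card => i; rewrite !inE.
Qed.

(** If all [N] spins are independent and equal to plus with probability [x], the
first [k] of them contain a binomial number of pluses. The proof compares the
coefficients of 'X^j in the generating function of the number of pluses among
the first [k] spins: the sites below [k] contribute a factor x 'X + (1 - x),
the other sites a factor 1. *)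
Lemma binomial_pmf_configs (R : realType) (k : nat) (x : R) (j : nat) :
  (k <= N)%N ->
  binomial_pmf k x j = \sum_(s : config N | pluses_below k s == j)
                         x ^+ pluses s * (1 - x) ^+ (N - pluses s).
Proof.
move=> kN.
pose F (i : 'I_N) (b : bool) : {poly R} :=
  (if b then x else 1 - x) *: 'X^((i < k)%N && b).
have FE (s : config N) : \prod_i F i (s i) =
    (x ^+ pluses s * (1 - x) ^+ (N - pluses s)) *: 'X^(pluses_below k s).
  rewrite scaler_prod prod_pluses; congr (_ *: _).
  rewrite -expr_sum; congr (_ ^+ _); rewrite /pluses_below -sum1_card.
  by rewrite [RHS]big_mkcond; apply: eq_bigr => i _; rewrite inE; case: (_ && _).
have := bigA_distr_bigA F.
transitivity ((\prod_i \sum_b F i b)`_j).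
  have -> : \prod_i \sum_b F i b = (x *: 'X + (1 - x)%:P) ^+ k.
    transitivity (\prod_(i < N | (i < k)%N) (x *: 'X + (1 - x)%:P)).
      rewrite [RHS]big_mkcond; apply: eq_bigr => i _.
      rewrite big_bool /F/= andbF expr0 andbT alg_polyC; case: ifP => _ //.
      by rewrite expr0 alg_polyC -polyCD addrC subrK.
    by rewrite -(big_ord_widen _ (fun=> x *: 'X + (1 - x)%:P))// prodr_const card_ord.
  rewrite addrC exprDn coef_sum /binomial_pmf.
  have E (i : 'I_k.+1) : ((1 - x)%:P ^+ (k - i) * (x *: 'X) ^+ i *+ 'C(k, i))`_j =
      if j == i then (1 - x) ^+ (k - i) * x ^+ i *+ 'C(k, i) else 0.
    rewrite coefMn exprZn -polyC_exp coefCM coefZ coefXn.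
    by case: eqP => _; rewrite ?mulr1 ?mulr0 ?mul0rn.
  under eq_bigr do rewrite E.
  have [kj|jk] := ltnP k j.
    rewrite bin_small// mulr0n big1// => i _; case: eqP => // ji.
    by move: kj; rewrite ji ltnNge -ltnS ltn_ord.
  rewrite -big_mkcond/= (big_pred1 (Ordinal (jk : (j < k.+1)%N)))//=.
  by rewrite mulrC.
rewrite bigA_distr_bigA coef_sum [RHS]big_mkcond; apply: eq_bigr => s _.
by rewrite FE coefZ coefXn eq_sym; case: eqP => _; rewrite ?mulr1 ?mulr0.
Qed.

End configurations.

(** * Reduction to the total number of pluses *)

Section reduction_to_counts.
Context {R : realType}.
Variables (N : nat) (beta h : R).

(** The Gibbs weight of a configuration with [l] pluses: the double sum over
the spins is the square of their sum, which is 2 l - N. *)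
Definition count_weight (l : nat) : R :=
  expR (beta / (2 * N%:R) * (2 * l%:R - N%:R) ^+ 2 + h * (2 * l%:R - N%:R)).

Lemma sum_spin (s : config N) :
  \sum_(i < N) spin R (s i) = 2 * (pluses s)%:R - N%:R.
Proof.
rewrite (eq_bigr (fun i => 2 * (s i)%:R - 1)); last first.
  by move=> i _; rewrite /spin; case: (s i) => /=; ring.
rewrite sumrB -mulr_sumr sumr_const card_ord; congr (_ * _ - _).
rewrite -natr_sum /pluses -sum1_card [in RHS]big_mkcond; congr (_%:R).
by apply: eq_bigr => i _; rewrite inE; case: (s i).
Qed.

Lemma cw_weightE (s : config N) : cw_weight beta h s = count_weight (pluses s).
Proof.
rewrite /cw_weight /count_weight; under eq_bigr do rewrite -mulr_sumr.
by rewrite -mulr_suml sum_spin expr2.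
Qed.

Lemma cw_partitionE :
  cw_partition N beta h = \sum_(l < N.+1) 'C(N, l)%:R * count_weight l.
Proof.
rewrite /cw_partition; under eq_bigr do rewrite cw_weightE.
by rewrite sum_pluses; apply: eq_bigr => l _; rewrite mulr_natl.
Qed.

Definition cw_count (l : nat) : R :=
  'C(N, l)%:R * (count_weight l / cw_partition N beta h).

(** The beta-binomial weights, that is, the mixed binomial distribution for
[k = N]. *)
Definition bb_count (a b : R) (l : nat) : R :=
  'C(N, l)%:R * (rbeta_fun (a + l%:R) (b + (N - l)%:R) / rbeta_fun a b).

(** Mixing the product measures on configurations over the beta distribution
gives an exchangeable law of configurations, under which the number of pluses
among the first [k] spins has the mixed binomial distribution. *)
Lemma mixed_binomial_configs (k : nat) (a b : R) (A : set R) : (k <= N)%N ->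
  1 < a -> 1 < b ->
  mixed_binomial k (rbeta_prob a b) A = (\sum_(s : config N)
    rbeta_fun (a + (pluses s)%:R) (b + (N - pluses s)%:R) / rbeta_fun a b
      * \1_A ((pluses_below k s)%:R : R))%:E.
Proof.
move=> kN a1 b1.
have pmfE (j : 'I_k.+1) : mixed_binomial_pmf k (rbeta_prob a b) j =
    (\sum_(s : config N | pluses_below k s == j)
      rbeta_fun (a + (pluses s)%:R) (b + (N - pluses s)%:R) / rbeta_fun a b)%:E.
  rewrite /mixed_binomial_pmf.
  transitivity (\int[rbeta_prob a b]_(x in `[0%R, 1%R])
     \sum_(s <- [seq s <- index_enum (config N) | pluses_below k s == j])
        (x ^+ pluses s * (1 - x) ^+ (N - pluses s))%:E)%E.
    apply: eq_integral => x _.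
    by rewrite (binomial_pmf_configs _ _ kN) sumEFin big_filter.
  rewrite ge0_integral_sum//=.
  - by rewrite big_filter -sumEFin; apply: eq_bigr => s _; exact: rbeta_moment.
  - move=> s; apply/measurable_EFinP/measurable_funTS; apply: measurable_funM.
      exact: measurable_funX.
    by apply: measurable_funX; exact: measurable_funB.
  - move=> s x /=; rewrite in_itv/= => /andP[x0 x1].
    by rewrite lee_fin mulr_ge0 ?exprn_ge0// subr_ge0.
rewrite /mixed_binomial; under eq_bigr do rewrite pmfE diracE -EFinM.
rewrite sumEFin; congr EFin.
rewrite [RHS](partition_big (fun s => inord (pluses_below k s) : 'I_k.+1) predT)//=.
apply: eq_bigr => j _; rewrite mulr_suml.
have same_block (s : config N) : (inord (pluses_below k s) == j) = (pluses_below k s == j :> nat).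
  have lt : (pluses_below k s < k.+1)%N by exact: (pluses_below_le s kN).
  by rewrite -(inj_eq val_inj)/= inordK.
under [RHS]eq_bigl do rewrite same_block.
by apply: eq_bigr => s /eqP ->; rewrite indicE.
Qed.

Lemma distribution_configs (k : nat) (A : set R) :
  distribution (curie_weiss N beta h) (@plus_count R N k) A =
  (\sum_(s : config N) count_weight (pluses s) / cw_partition N beta h
      * \1_A ((pluses_below k s)%:R : R))%:E.
Proof.
rewrite /distribution /pushforward /curie_weiss -sumEFin.
by apply: eq_bigr => s _; rewrite cw_weightE diracE -EFinM indicE.
Qed.

(** Both distributions are images, under the same map [pluses_below k], of
exchangeable laws on configurations, so their distance is at most the l1
distance of these laws. As the weight of a configuration depends only on its
number of pluses, this l1 distance is that of the laws of the total number of
pluses, whatever [k] is. *)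
Lemma dTV_le_counts (k : nat) (a b : R) : (k <= N)%N -> 1 < a -> 1 < b ->
  (dTV (distribution (curie_weiss N beta h) (@plus_count R N k))
       (mixed_binomial k (rbeta_prob a b))
   <= (\sum_(l < N.+1) `|cw_count l - bb_count a b l|)%:E)%E.
Proof.
move=> kN a1 b1; apply: ge_ereal_sup => _ [A mA <-].
(* The distance evaluates the two measures through their bundled structures;
   the formulas for them apply to the unbundled set functions. *)
have := lexx (`|distribution (curie_weiss N beta h) (@plus_count R N k) A -
  mixed_binomial k (rbeta_prob a b) A|%E).
rewrite [leRHS](congr2 (fun x y => `|x - y|%E) (distribution_configs k A)
  (mixed_binomial_configs A kN a1 b1)) => /le_trans; apply.
rewrite -EFinB abse_EFin lee_fin -sumrB.
pose w l := count_weight l / cw_partition N beta h.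
pose q l := rbeta_fun (a + l%:R) (b + (N - l)%:R) / rbeta_fun a b.
apply: (@le_trans _ _ (\sum_(s : config N) `|w (pluses s) - q (pluses s)|)).
  apply: (le_trans (ler_norm_sum _ _ _)); apply: ler_sum => s _.
  rewrite -mulrBl normrM ler_piMr//.
  by rewrite indicE; case: (_ \in _); rewrite ?normr1 ?normr0.
rewrite (sum_pluses N (fun l => `|w l - q l|)) le_eqVlt; apply/orP; left.
apply/eqP; apply: eq_bigr => l _.
by rewrite /cw_count /bb_count -mulrBr normrM normr_nat mulr_natl.
Qed.

End reduction_to_counts.

(** * The hyperbolic tangent *)

Section hyperbolic_tangent.
Context {R : realType}.
Implicit Types u v x : R.

Let ch_gt0 x : 0 < expR x + expR (- x).
Proof. by rewrite addr_gt0 ?expR_gt0. Qed.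

Lemma tanhN x : tanh (- x) = - tanh x.
Proof. by rewrite /tanh opprK -mulNr opprB [expR (- x) + expR x]addrC. Qed.

Lemma tanh0 : tanh (0 : R) = 0.
Proof. by rewrite /tanh oppr0 subrr mul0r. Qed.

Lemma tanh_lt1 x : tanh x < 1.
Proof.
rewrite /tanh ltr_pdivrMr ?ch_gt0// mul1r.
by rewrite ltrBlDr -addrA ltrDl addr_gt0 ?expR_gt0.
Qed.

Lemma tanh_gtN1 x : -1 < tanh x.
Proof. by rewrite ltrNl -tanhN tanh_lt1. Qed.

Lemma normr_tanh_lt1 x : `|tanh x| < 1.
Proof. by rewrite ltr_norml tanh_gtN1 tanh_lt1. Qed.

Lemma sqr_tanh_lt1 x : tanh x ^+ 2 < 1.
Proof. by rewrite -real_normK ?num_real// expr_lt1// normr_tanh_lt1. Qed.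

(** The logistic function is the conditional probability of a plus given the
other spins; this is how the hyperbolic tangent enters. *)
Lemma tanh_logistic x : (1 + expR (- (2 * x)))^-1 = (1 + tanh x) / 2.
Proof.
have e0 := expR_gt0 x; have e1 := expR_gt0 (- x).
have -> : expR (- (2 * x)) = expR (- x) ^+ 2.
  by rewrite -expRM_natl; congr expR; ring.
have E : expR x * expR (- x) = 1 by rewrite -expRD subrr expR0.
rewrite /tanh.
have -> : 1 + expR (- x) ^+ 2 = expR (- x) * (expR x + expR (- x)) by nra.
field: E; rewrite ?gt_eqF ?mulr_gt0//.
Qed.

Global Instance is_derive_tanh x : is_derive x 1 tanh (1 - tanh x ^+ 2).
Proof.
have cx := ch_gt0 x.
have D0 : is_derive x 1 (fun y => expR (- y)) (expR (- x) * (- 1)).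
  exact: (@is_derive1_comp _ expR (fun y => - y)).
have D1 : is_derive x 1 (fun y => expR y - expR (- y)) (expR x + expR (- x)).
  by apply: is_derive_eq; rewrite mulrN1 opprK.
have D2 : is_derive x 1 (fun y => expR y + expR (- y)) (expR x - expR (- x)).
  by apply: is_derive_eq; rewrite mulrN1.
have D3 := is_deriveV (lt0r_neq0 cx : (fun y => expR y + expR (- y)) x != 0).
have D4 := is_deriveM D1 (D3 _ _ D2).
apply: is_derive_eq D4 _.
rewrite /tanh /GRing.scale/=; field.
by rewrite gt_eqF.
Qed.

Lemma continuous_tanh : continuous (tanh : R -> R).
Proof.
move=> x; apply: differentiable_continuous.
by apply/derivable1_diffP; exact: ex_derive.
Qed.

Lemma tanh_MVT u v : u < v ->
  exists2 c, u < c < v & tanh v - tanh u = (1 - tanh c ^+ 2) * (v - u).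
Proof.
move=> uv.
have [|c] := @MVT _ tanh (fun x => 1 - tanh x ^+ 2) u v uv.
  exact/continuous_subspaceT/continuous_tanh.
by rewrite in_itv/= => cuv ->; exists c.
Qed.

Lemma ltr_tanh : {homo (tanh : R -> R) : u v / u < v}.
Proof.
move=> u v uv; rewrite -subr_gt0; have [c _ ->] := tanh_MVT uv.
by rewrite mulr_gt0 ?subr_gt0// sqr_tanh_lt1.
Qed.

Lemma ler_tanh : {homo (tanh : R -> R) : u v / u <= v}.
Proof. by move=> u v; rewrite le_eqVlt => /predU1P[->//|/ltr_tanh/ltW]. Qed.

Lemma tanh_lipschitz u v : `|tanh u - tanh v| <= `|u - v|.
Proof.
wlog uv : u v / u < v => [W|].
  by have [/W//|/W|->] := ltgtP u v; rewrite ?subrr// distrC [leRHS]distrC.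
rewrite distrC [leRHS]distrC; have [c _ ->] := tanh_MVT uv.
have t0 : 0 <= 1 - tanh c ^+ 2 by rewrite subr_ge0 ltW// sqr_tanh_lt1.
by rewrite normrM ler_piMl// ger0_norm// gerBl sqr_ge0.
Qed.

(** The graph lies below its tangents on the positive half-line, because the
derivative 1 - tanh^2 decreases there. *)
Lemma tanh_tangent u v : 0 <= u -> 0 <= v ->
  tanh u - tanh v <= (1 - tanh v ^+ 2) * (u - v).
Proof.
have sq x y : 0 <= x -> x < y -> tanh x ^+ 2 <= tanh y ^+ 2.
  move=> x0 /ltW xy; have tx : 0 <= tanh x by rewrite -tanh0 ler_tanh.
  by rewrite lerXn2r ?nnegrE// ?ler_tanh// (le_trans tx)// ler_tanh.
move=> u0 v0; have [uv|vu|->] := ltgtP u v; last by rewrite !subrr mulr0.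
  rewrite -opprB lerNl -mulrN opprB.
  have [c /andP[uc cv] ->] := tanh_MVT uv.
  apply: ler_wpM2r; first by rewrite subr_ge0 ltW.
  by rewrite lerD2l lerN2 sq// (le_trans u0)// ltW.
have [c /andP[vc cu] ->] := tanh_MVT vu.
apply: ler_wpM2r; first by rewrite subr_ge0 ltW.
by rewrite lerD2l lerN2 sq.
Qed.

End hyperbolic_tangent.

(** * The mean-field equation *)

Section mean_field_equation.
Context {R : realType}.
Implicit Types beta h z m : R.

Definition mean_field beta h z : R := tanh (beta * z + h).

(** The property by which [magnetization] selects its value. *)
Definition extremal_solution beta h z : Prop :=
  z = mean_field beta h z /\
  forall z', z' = mean_field beta h z' -> `|z'| <= `|z|.

Lemma mean_fieldN beta h z : mean_field beta (- h) (- z) = - mean_field beta h z.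
Proof. by rewrite /mean_field mulrN -opprD tanhN. Qed.

Lemma extremal_solutionN beta h z :
  extremal_solution beta (- h) z <-> extremal_solution beta h (- z).
Proof.
have E y : y = mean_field beta (- h) y <-> - y = mean_field beta h (- y).
  have -> : mean_field beta h (- y) = - mean_field beta (- h) y.
    by rewrite -{1}[h]opprK mean_fieldN.
  by split=> [<-//|/oppr_inj].
split=> -[/E zE zM]; split=> // z' z'E.
  by rewrite normrN -[`|z'|]normrN; apply: zM; apply/E; rewrite opprK.
by rewrite -[`|z|]normrN -[`|z'|]normrN; apply: zM; apply/E.
Qed.

Lemma magnetization_eq beta h m :
  (forall z, extremal_solution beta h z <-> z = m) -> magnetization beta h = m.
Proof.
move=> H; apply/(H _).1.
by apply: (@xgetPex _ 0 (extremal_solution beta h)); exists m; exact/H.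
Qed.

Lemma continuous_mean_field_gap beta h :
  continuous (fun z => z - mean_field beta h z).
Proof.
move=> z; apply: cvgB; first exact: cvg_id.
apply: (@continuous_comp _ _ _ (fun z => beta * z + h) tanh);
  last exact: continuous_tanh.
by apply: cvgD; [apply: cvgM; [exact: cvg_cst|exact: cvg_id]|exact: cvg_cst].
Qed.

(** For beta < 1 the mean-field map is a contraction with ratio beta. *)
Lemma mean_field_gap_contraction beta h m z : 0 < beta -> m = mean_field beta h m ->
  (1 - beta) * `|z - m| <= `|z - mean_field beta h z|.
Proof.
move=> b0 mE.
have : `|mean_field beta h z - m| <= beta * `|z - m|.
  rewrite {1}mE (le_trans (tanh_lipschitz _ _))//.
  have -> : beta * z + h - (beta * m + h) = beta * (z - m) by ring.
  by rewrite normrM gtr0_norm.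
have := ler_normD (z - mean_field beta h z) (mean_field beta h z - m).
rewrite addrA subrK; lra.
Qed.

Lemma magnetization_contraction beta h : 0 < beta < 1 ->
  magnetization beta h = mean_field beta h (magnetization beta h).
Proof.
move=> /andP[b0 b1].
have [m _ /eqP] : exists2 m, m \in `[-1, 1] & m - mean_field beta h m = 0.
  apply: (@IVT _ _ (-1) 1 0); first lra.
    exact/continuous_subspaceT/continuous_mean_field_gap.
  rewrite ge_min le_max; apply/andP; split; apply/orP; [left|right].
    by have := tanh_gtN1 (beta * -1 + h); rewrite /mean_field; lra.
  by have := tanh_lt1 (beta * 1 + h); rewrite /mean_field; lra.
rewrite subr_eq0 => /eqP mE.
have uni z : z = mean_field beta h z -> z = m.
  move=> zE; have := mean_field_gap_contraction z b0 mE.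
  rewrite -zE subrr normr0 pmulr_rle0 ?subr_gt0// normr_le0 subr_eq0.
  by move/eqP.
suff -> : magnetization beta h = m by [].
apply: magnetization_eq => z; split=> [[zE _]|->]; first exact: uni.
by split=> // z' /uni ->.
Qed.

(* For h > 0 and large beta the mean-field map need not be a contraction and
   may have several fixed points, but it is concave on the positive half-line
   and positive at 0. A concave function that is positive at 0 crosses the
   diagonal once, and does so transversally, which the next two lemmas quantify:
   the chord from 0 to the fixed point m has slope 1 - tanh h / m. *)
Section positive_field.
Variables (beta h m : R).
Hypotheses (b0 : 0 < beta) (h0 : 0 < h) (m0 : 0 < m).
Hypothesis mE : m = mean_field beta h m.

Let T0 : mean_field beta h 0 = tanh h.
Proof. by rewrite /mean_field mulr0 add0r. Qed.

Let slope z := beta * (1 - mean_field beta h z ^+ 2).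

Let tangent z z' : 0 <= z -> 0 <= z' ->
  mean_field beta h z' - mean_field beta h z <= slope z * (z' - z).
Proof.
move=> z0 z'0; apply: le_trans (tanh_tangent _ _) _.
- by rewrite addr_ge0 ?mulr_ge0// ltW.
- by rewrite addr_ge0 ?mulr_ge0// ltW.
by rewrite /slope /mean_field; lra.
Qed.

Lemma mean_field_gap_below z : 0 <= z -> z <= m ->
  tanh h / m * (m - z) <= mean_field beta h z - z.
Proof.
move=> z0 zm.
have := tangent z0 (lexx 0); have := tangent z0 (ltW m0).
rewrite T0 -mE; set s := slope z; set T := mean_field _ _ _.
have mz : 0 <= m - z by rewrite subr_ge0.
move=> /(ler_wpM2r z0) H1 /(ler_wpM2r mz) H2.
by rewrite mulrAC ler_pdivrMr//; lra.
Qed.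

Lemma mean_field_gap_above z : m <= z ->
  tanh h / m * (z - m) <= z - mean_field beta h z.
Proof.
move=> mz; have z0 : 0 < z by exact: lt_le_trans mz.
have := tangent (ltW m0) (lexx 0); have := tangent (ltW m0) (ltW z0).
rewrite T0 -mE; set s := slope m; set T := mean_field _ _ _.
have zm : 0 <= z - m by rewrite subr_ge0.
move=> /(ler_wpM2r (ltW m0)) H1 /(ler_wpM2r zm) H2.
by rewrite mulrAC ler_pdivrMr//; lra.
Qed.

(** The tangent at [m] is above the graph at 0, where the graph is
positive. *)
Lemma mean_field_slope_lt1 : beta * (1 - m ^+ 2) < 1.
Proof.
have := tangent (ltW m0) (lexx 0); rewrite T0 -mE sub0r /slope -mE => H.
have th0 : 0 < tanh h by rewrite -tanh0 ltr_tanh.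
by rewrite -(ltr_pM2r m0); lra.
Qed.

Lemma mean_field_gap_pos z : 0 <= z ->
  tanh h / m * `|z - m| <= `|z - mean_field beta h z|.
Proof.
move=> z0; have [zm|/ltW mz] := leP z m.
  rewrite distrC ger0_norm ?subr_ge0// (le_trans (mean_field_gap_below z0 zm))//.
  by rewrite distrC ler_norm.
by rewrite ger0_norm ?subr_ge0// (le_trans (mean_field_gap_above mz))// ler_norm.
Qed.

(** On the positive side a point below its image is at most [m]. If [y < 0] is
a fixed point, then [- y] is strictly below its image because the field helps the
positive side, so [- y < m]. Hence [m] is the only solution of largest
absolute value. *)
Lemma extremal_solution_pos z : extremal_solution beta h z <-> z = m.
Proof.
have th0 : 0 < tanh h by rewrite -tanh0 ltr_tanh.
have c0 : 0 < tanh h / m by rewrite divr_gt0.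
have uni y : 0 <= y -> y <= mean_field beta h y -> y <= m.
  move=> y0 yE; rewrite leNgt; apply/negP => my.
  have := mean_field_gap_above (ltW my); have : 0 < tanh h / m * (y - m).
    by rewrite mulr_gt0// subr_gt0.
  lra.
have neg y : y < 0 -> y = mean_field beta h y -> - y < m.
  move=> y0 yE.
  have lt : - y < mean_field beta h (- y).
    rewrite {1}yE /mean_field -tanhN; apply: ltr_tanh.
    by move: h0; rewrite mulrN; lra.
  rewrite lt_neqAle uni ?ltW ?oppr_gt0// andbT; apply/eqP => yM.
  by move: lt; rewrite yM -mE ltxx.
have bound y : y = mean_field beta h y -> `|y| <= m.
  move=> yE; have [y0|y0] := leP 0 y.
    by rewrite ger0_norm// uni// -yE.
  by rewrite ltr0_norm// ltW// neg.
split=> [[zE zM]|->]; last by split=> // z' /bound; rewrite (gtr0_norm m0).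
have := zM _ mE; rewrite (gtr0_norm m0) => mz.
have zm := le_anti (introT andP (conj (bound z zE) mz)).
have [z0|z0] := leP 0 z; first by rewrite -zm ger0_norm.
by have := neg _ z0 zE; rewrite -{1}zm ltr0_norm// ltxx.
Qed.

End positive_field.

Lemma magnetization_pos beta h : 0 < beta -> 0 < h ->
  0 < magnetization beta h /\
  magnetization beta h = mean_field beta h (magnetization beta h).
Proof.
move=> b0 h0; have th0 : 0 < tanh h by rewrite -tanh0 ltr_tanh.
have [m mI /eqP] : exists2 m, m \in `[0, 1] & m - mean_field beta h m = 0.
  apply: (@IVT _ _ 0 1 0); first lra.
    exact/continuous_subspaceT/continuous_mean_field_gap.
  rewrite ge_min le_max; apply/andP; split; apply/orP; [left|right].
    by rewrite /mean_field mulr0 !add0r oppr_le0 ltW.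
  by have := tanh_lt1 (beta * 1 + h); rewrite /mean_field; lra.
rewrite subr_eq0 => /eqP mE.
have m0 : 0 < m.
  move: mI; rewrite in_itv/= le_eqVlt => /andP[/predU1P[m0|//] _].
  have E : m = tanh h by rewrite mE -m0 /mean_field mulr0 add0r.
  by move: th0; rewrite -E -m0 ltxx.
suff -> : magnetization beta h = m by [].
by apply: magnetization_eq => z; exact: extremal_solution_pos.
Qed.

Lemma magnetizationN beta h : 0 < beta -> 0 < h ->
  magnetization beta (- h) = - magnetization beta h.
Proof.
move=> b0 h0; have [m0 mE] := magnetization_pos b0 h0.
have P z := extremal_solution_pos b0 h0 m0 mE z.
apply: magnetization_eq => z; split=> [/extremal_solutionN/P <-|->].
  by rewrite opprK.
by apply/extremal_solutionN/P; rewrite opprK.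
Qed.

End mean_field_equation.

(** * Second moments from detailed balance *)

Section detailed_balance.
Context {R : realType}.

(** Let [p] be reversible for the birth-death chain with rates [b] and [d].
Summation by parts against the test function D = b - d, the drift of the chain,
gives E[D^2] = E[b (D - D(. + 1))], and the right side is small when the drift
varies slowly. With rates of order N and a drift with bounded increments this
bounds E[D^2] by a constant times N, so that the law concentrates at scale
sqrt N around the zeros of the drift. *)
Lemma birth_death_second_moment (N : nat) (p b d : nat -> R) (C L : R) :
  0 <= C -> 0 <= L ->
  (forall j, (j <= N)%N -> 0 <= p j) ->
  (forall j, (j < N)%N -> p j * b j = p j.+1 * d j.+1) ->
  b N = 0 -> d 0%N = 0 ->
  (forall j, (j < N)%N -> 0 <= b j <= C) ->
  (forall j, (j < N)%N -> `|(b j - d j) - (b j.+1 - d j.+1)| <= L) ->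
  \sum_(j < N.+1) p j * (b j - d j) ^+ 2 <= C * L * \sum_(j < N.+1) p j.
Proof.
move=> C0 L0 p0 bal bN d0 bC lip; pose D j := b j - d j.
have -> : \sum_(j < N.+1) p j * (b j - d j) ^+ 2 =
    \sum_(j < N) p j * b j * (D j - D j.+1).
  transitivity (\sum_(j < N.+1) p j * b j * D j - \sum_(j < N.+1) p j * d j * D j).
    by rewrite -sumrB; apply: eq_bigr => j _; rewrite /D; ring.
  rewrite big_ord_recr/= bN mulr0 mul0r addr0.
  rewrite [X in _ - X]big_ord_recl/= d0 mulr0 mul0r add0r -sumrB.
  by apply: eq_bigr => j _; rewrite -[bump 0 j]/(j.+1) -(bal j (ltn_ord j)) -mulrBr.
apply: (@le_trans _ _ (\sum_(j < N) C * L * p j)).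
  apply: ler_sum => j _; rewrite -mulrA [leRHS]mulrC.
  apply: ler_wpM2l; first by rewrite p0// ltnW.
  have /andP[b0 bc] := bC j (ltn_ord j).
  apply: (le_trans (ler_norm _)); rewrite normrM ger0_norm//.
  by apply: ler_pM => //; exact: (lip j (ltn_ord j)).
by rewrite -mulr_sumr big_ord_recr/= mulrDr lerDl !mulr_ge0// p0.
Qed.


Lemma bb_count_rec (N : nat) (a b : R) (l : nat) : 1 < a -> 1 < b -> (l < N)%N ->
  bb_count N a b l * ((N%:R - l%:R) * (l%:R + a)) =
  bb_count N a b l.+1 * (l.+1%:R * (N%:R - l.+1%:R + b)).
Proof.
move=> a1 b1 lN.
have bin : 'C(N, l)%:R * (N%:R - l%:R) = 'C(N, l.+1)%:R * l.+1%:R :> R.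
  by rewrite -natrB ?(ltnW lN)// -!natrM mulnC -mul_bin_left mulnC.
have al1 : 1 < a + l%:R by rewrite (lt_le_trans a1)// lerDl.
have bl1 : 1 < b + (N - l.+1)%:R by rewrite (lt_le_trans b1)// lerDl.
have := rbeta_fun_rec al1 bl1.
have -> : a + l%:R + 1 = a + l.+1%:R by rewrite -natr1; ring.
have -> : b + (N - l.+1)%:R + 1 = b + (N - l)%:R by rewrite -addrA natr1 subnSK.
rewrite /bb_count -(natrB _ lN) => E.
rewrite [l%:R + a]addrC [_ + b]addrC.
transitivity ('C(N, l)%:R * (N%:R - l%:R) / rbeta_fun a b *
   ((a + l%:R) * rbeta_fun (a + l%:R) (b + (N - l)%:R))); first by ring.
by rewrite -E bin; ring.
Qed.

Lemma bb_count_ge0 (N : nat) (a b : R) (l : nat) : 0 <= bb_count N a b l.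
Proof.
rewrite /bb_count mulr_ge0// divr_ge0//;
by apply: Rintegral_ge0 => x _; rewrite mulr_ge0 ?powR_ge0.
Qed.

Lemma bb_count_gt0 (N : nat) (a b : R) (l : nat) : 1 < a -> 1 < b ->
  (l <= N)%N -> 0 < bb_count N a b l.
Proof.
move=> a1 b1 lN; rewrite /bb_count mulr_gt0 ?ltr0n ?bin_gt0// divr_gt0//.
  by apply: rbeta_fun_gt0; [rewrite (lt_le_trans a1)//|rewrite (lt_le_trans b1)//];
    rewrite lerDl.
exact: rbeta_fun_gt0.
Qed.

Lemma sum_bb_count (N : nat) (a b : R) : 1 < a -> 1 < b ->
  \sum_(l < N.+1) bb_count N a b l = 1.
Proof. exact: rbeta_binomial_sum. Qed.

(** The beta-binomial law is reversible for quadratic rates whose difference is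
affine, so the drift is itself a multiple of the centred number of pluses. *)
Lemma bb_second_moment (N : nat) (a b : R) : 1 < a -> 1 < b ->
  \sum_(l < N.+1) bb_count N a b l * (N%:R * a - l%:R * (a + b)) ^+ 2
    <= N%:R * (N%:R + a) * (a + b).
Proof.
move=> a1 b1.
have a0 : 0 < a by lra.
have b0 : 0 < b by lra.
pose u (l : nat) : R := (N%:R - l%:R) * (l%:R + a).
pose v (l : nat) : R := l%:R * (N%:R - l%:R + b).
have uvE l : u l - v l = N%:R * a - l%:R * (a + b) by rewrite /u /v; ring.
under eq_bigr do rewrite -uvE.
rewrite -[leRHS]mulr1 -[X in _ * X](sum_bb_count N a1 b1).
apply: birth_death_second_moment.
- by rewrite mulr_ge0// addr_ge0// ltW.
- by rewrite addr_ge0// ltW.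
- by move=> l _; exact: bb_count_ge0.
- by move=> l; exact: bb_count_rec.
- by rewrite /u subrr mul0r.
- by rewrite /v mul0r.
- move=> l lN; have lN' : l%:R <= N%:R :> R by rewrite ler_nat ltnW.
  have l0 : 0 <= l%:R :> R by [].
  rewrite /u mulr_ge0 ?subr_ge0 ?addr_ge0 ?(ltW a0)//= ler_pM ?subr_ge0 ?addr_ge0 ?(ltW a0)//.
    by rewrite gerBl.
  by rewrite lerD2r.
- move=> l lN; rewrite !uvE -natr1 [X in `|X|](_ : _ = a + b); last by ring.
  by rewrite ger0_norm// addr_ge0// ltW.
Qed.

End detailed_balance.

(** * Concentration of the Curie-Weiss model *)

Section curie_weiss_moments.
Context {R : realType}.
Implicit Types beta h : R.

Lemma count_weight_gt0 (N : nat) beta h l : 0 < count_weight N beta h l.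
Proof. exact: expR_gt0. Qed.

Lemma cw_count_gt0 (N : nat) beta h l : (l <= N)%N -> 0 < cw_count N beta h l.
Proof.
move=> lN; rewrite mulr_gt0 ?ltr0n ?bin_gt0// divr_gt0 ?count_weight_gt0//.
exact: cw_partition_gt0.
Qed.

Lemma cw_count_ge0 (N : nat) beta h l : 0 <= cw_count N beta h l.
Proof. by rewrite mulr_ge0// divr_ge0 ?expR_ge0// ltW// cw_partition_gt0. Qed.

Lemma sum_cw_count (N : nat) beta h : \sum_(l < N.+1) cw_count N beta h l = 1.
Proof.
under eq_bigr do rewrite /cw_count mulrA.
by rewrite -mulr_suml -cw_partitionE divff// gt_eqF// cw_partition_gt0.
Qed.

(** The logarithm of the ratio of the Gibbs weights of two configurations that
differ by one additional plus on top of [x] pluses. *)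
Definition cw_drift (N : nat) beta h (x : R) : R :=
  2 * beta * (2 * x + 1 - N%:R) / N%:R + 2 * h.

Lemma cw_count_rec (N : nat) beta h l : (l < N)%N ->
  cw_count N beta h l * ((N%:R - l%:R) * expR (cw_drift N beta h l%:R)) =
  cw_count N beta h l.+1 * l.+1%:R.
Proof.
move=> lN; have N0 : N%:R != 0 :> R by rewrite pnatr_eq0 -lt0n (leq_trans _ lN).
have bin : 'C(N, l)%:R * (N%:R - l%:R) = 'C(N, l.+1)%:R * l.+1%:R :> R.
  by rewrite -natrB ?(ltnW lN)// -!natrM mulnC -mul_bin_left mulnC.
have -> : cw_count N beta h l.+1 * l.+1%:R =
    'C(N, l.+1)%:R * l.+1%:R * (count_weight N beta h l.+1 / cw_partition N beta h).
  by rewrite /cw_count; ring.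
rewrite -bin /cw_count.
have -> : count_weight N beta h l.+1 =
    count_weight N beta h l * expR (cw_drift N beta h l%:R).
  rewrite /count_weight -expRD; congr expR.
  by rewrite /cw_drift -natr1; field.
by ring.
Qed.

Definition mean_spin (N : nat) (l : nat) : R := (2 * l%:R - N%:R) / N%:R.

(** Heat-bath rates: a minus turns into a plus with the conditional probability
(1 + t) / 2 of a plus, and conversely with probability (1 - t) / 2. Twice the
resulting drift is N (mean_field z - z) up to a bounded error, where z is the
mean spin; the error comes from the self-interaction of a spin, of order 1/N. *)
Lemma cw_gap_moment (N : nat) beta h : 0 < beta -> (0 < N)%N ->
  \sum_(l < N.+1) cw_count N beta h l *
    (N%:R * (mean_spin N l - mean_field beta h (mean_spin N l))) ^+ 2
  <= (16 * (beta + 1) + 18 * beta ^+ 2) * N%:R.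
Proof.
move=> b0 N0; have n0 : 0 < N%:R :> R by rewrite ltr0n.
have n1 : 1 <= N%:R :> R by rewrite ler1n.
pose t (x : R) := tanh (beta * (2 * x + 1 - N%:R) / N%:R + h).
have t1 x : `|t x| <= 1 by exact/ltW/normr_tanh_lt1.
have tlip x : N%:R * `|t (x + 1) - t x| <= 2 * beta.
  rewrite -ler_pdivlMl// (le_trans (tanh_lipschitz _ _))//.
  rewrite [X in `|X|](_ : _ = N%:R^-1 * (2 * beta)); last by field; rewrite gt_eqF.
  by rewrite ger0_norm// mulr_ge0 ?invr_ge0 ?mulr_ge0// ltW.
pose u (l : nat) : R := (N%:R - l%:R) * ((1 + t l%:R) / 2).
pose d (l : nat) : R := l%:R * ((1 - t (l%:R - 1)) / 2).
have bal l : (l < N)%N -> cw_count N beta h l * u l =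
    cw_count N beta h l.+1 * d l.+1.
  move=> lN; rewrite /d [RHS]mulrA -cw_count_rec// /u -[X in t (X - 1)]natr1 addrK.
  have := tanh_logistic (beta * (2 * l%:R + 1 - N%:R) / N%:R + h).
  rewrite -/(t l%:R) (_ : 2 * _ = cw_drift N beta h l%:R); last first.
    by rewrite /cw_drift; ring.
  set D := cw_drift _ _ _ _ => E.
  have e0 := expR_gt0 D.
  have E' : expR D * ((1 - t l%:R) / 2) = (1 + t l%:R) / 2.
    have -> : (1 - t l%:R) / 2 = 1 - (1 + t l%:R) / 2 by field.
    rewrite -E expRN; field.
    by rewrite !gt_eqF// addr_gt0.
  by rewrite -!mulrA E'.
have D1 l : (l < N)%N -> `|u l - d l - (u l.+1 - d l.+1)| <= 2 * (beta + 1).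
  move=> lN; have lN' : l%:R + 1 <= N%:R :> R by rewrite natr1 ler_nat.
  have l0 : 0 <= l%:R :> R by [].
  rewrite /u /d; have -> : l.+1%:R = l%:R + 1 :> R by rewrite natr1.
  rewrite addrK.
  have := tlip l%:R; have := tlip (l%:R - 1); rewrite subrK.
  have := t1 (l%:R - 1); have := t1 (l%:R + 1); have := t1 l%:R.
  move: (t (l%:R - 1)) (t l%:R) (t (l%:R + 1)) lN' l0 => x y z.
  move: (l%:R) (N%:R : R) n0 => k n n0 kn k0 /ler_normlP[y1 y2]
    /ler_normlP[z1 z2] /ler_normlP[x1 x2] yx zy.
  have A : `|(n - k - 1) * (z - y)| <= 2 * beta.
    rewrite normrM (le_trans _ zy)// ler_wpM2r// ger0_norm; lra.
  have B : `|k * (y - x)| <= 2 * beta.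
    rewrite normrM (le_trans _ yx)// ler_wpM2r// ger0_norm; lra.
  move: A B => /ler_normlP[A1 A2] /ler_normlP[B1 B2].
  by apply/ler_normlP; split; lra.
have u01 l : (l < N)%N -> 0 <= u l <= N%:R.
  move=> lN; have lN' : l%:R <= N%:R :> R by rewrite ler_nat ltnW.
  have /ler_normlP[y1 y2] := t1 l%:R.
  have y0 : 0 <= (1 + t l%:R) / 2 by lra.
  rewrite /u mulr_ge0 ?subr_ge0//=.
  rewrite -[leRHS]mulr1 ler_pM ?subr_ge0// ?gerBl//; lra.
have S : \sum_(l < N.+1) cw_count N beta h l * (u l - d l) ^+ 2
    <= N%:R * (2 * (beta + 1)).
  rewrite -[leRHS]mulr1 -[X in _ * X](sum_cw_count N beta h).
  apply: birth_death_second_moment => //.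
  - by rewrite mulr_ge0// addr_ge0// ltW.
  - by move=> l _; exact: cw_count_ge0.
  - by rewrite /u subrr mul0r.
  - by rewrite /d mul0r.
apply: (@le_trans _ _ (\sum_(l < N.+1) (8 * (cw_count N beta h l * (u l - d l) ^+ 2)
    + 18 * beta ^+ 2 * cw_count N beta h l))).
  apply: ler_sum => l _.
  have lN : l%:R <= N%:R :> R by rewrite ler_nat -ltnS.
  have : `|N%:R * (mean_spin N l - mean_field beta h (mean_spin N l)) + 2 * (u l - d l)|
      <= 3 * beta.
    have B : `|l%:R * (t l%:R - t (l%:R - 1))| <= 2 * beta.
      have := tlip (l%:R - 1); rewrite subrK normrM ger0_norm//.
      by apply: le_trans; rewrite ler_wpM2r.
    have A : `|N%:R * (t l%:R - mean_field beta h (mean_spin N l))| <= beta.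
      rewrite normrM gtr0_norm// -ler_pdivlMl// (le_trans (tanh_lipschitz _ _))//.
      rewrite [X in `|X|](_ : _ = N%:R^-1 * beta).
        by rewrite ger0_norm// mulr_ge0 ?invr_ge0// ltW.
      by rewrite /mean_spin; field; rewrite gt_eqF.
    have -> : N%:R * (mean_spin N l - mean_field beta h (mean_spin N l)) + 2 * (u l - d l)
       = N%:R * (t l%:R - mean_field beta h (mean_spin N l))
         - l%:R * (t l%:R - t (l%:R - 1)).
      by rewrite /mean_spin /u /d; field; rewrite gt_eqF.
    by rewrite (le_trans (ler_normB _ _))//; lra.
  move: (N%:R * _) (u l - d l) => x y.
  move=> /ler_normlP[x1 x2]; set p := cw_count _ _ _ _.
  have p0 : 0 <= p by exact: cw_count_ge0.
  have E : x ^+ 2 <= 8 * y ^+ 2 + 18 * beta ^+ 2.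
    have w1 : 0 <= 3 * beta - (x + 2 * y) by lra.
    have w2 : 0 <= 3 * beta + (x + 2 * y) by lra.
    have := mulr_ge0 w1 w2; have := sqr_ge0 (x + 4 * y); lra.
  have := ler_wpM2l p0 E; lra.
rewrite big_split/= -!mulr_sumr sum_cw_count mulr1.
have : beta ^+ 2 <= beta ^+ 2 * N%:R by rewrite ler_peMr// sqr_ge0.
by move: S; lra.
Qed.

End curie_weiss_moments.

Section curie_weiss_concentration.
Context {R : realType}.
Implicit Types beta h m : R.

Lemma count_weight_reflect (N : nat) beta h l : (l <= N)%N ->
  count_weight N beta h (N - l) = count_weight N beta (- h) l.
Proof.
move=> lN; rewrite /count_weight natrB//; congr expR; ring.
Qed.

Lemma cw_count_reflect (N : nat) beta h l : (l <= N)%N ->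
  cw_count N beta h (N - l) = cw_count N beta (- h) l.
Proof.
move=> lN; rewrite /cw_count (count_weight_reflect beta h lN) (bin_sub lN).
congr (_ * (_ / _)); rewrite !cw_partitionE.
rewrite (reindex_inj rev_ord_inj)/=; apply: eq_bigr => i _.
have iN : (i <= N)%N by rewrite -ltnS.
by rewrite subSS (bin_sub iN) (count_weight_reflect beta h iN).
Qed.

Lemma sum_rev (N : nat) (F : nat -> R) :
  \sum_(l < N.+1) F l = \sum_(l < N.+1) F (N - l)%N.
Proof.
by rewrite (reindex_inj rev_ord_inj)/=; apply: eq_bigr => i _; rewrite subSS.
Qed.

Lemma cw_count_flip (N : nat) beta h l : (l <= N)%N ->
  cw_count N beta h (N - l) =
  cw_count N beta h l * expR (- (2 * h * (2 * l%:R - N%:R))).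
Proof.
move=> lN; have E : count_weight N beta h (N - l) =
    count_weight N beta h l * expR (- (2 * h * (2 * l%:R - N%:R))).
  by rewrite /count_weight -expRD natrB//; congr expR; ring.
by rewrite /cw_count (bin_sub lN) E; ring.
Qed.

(** In terms of the number [l] of pluses, [N%:R * (mean_spin N l - m)] is
2 l - N - N m, twice the deviation of [l] from its centre N (1 + m) / 2. *)
Definition cw_second_moment (N : nat) beta h m : R :=
  \sum_(l < N.+1) cw_count N beta h l * (N%:R * (mean_spin N l - m)) ^+ 2.

Lemma sqr_scaled_le (n c x y : R) : 0 <= c -> c * `|x| <= `|y| ->
  (n * x) ^+ 2 * c ^+ 2 <= (n * y) ^+ 2.
Proof.
move=> c0 H; rewrite !exprMn -mulrA ler_wpM2l ?sqr_ge0// mulrC -exprMn.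
rewrite -[leLHS]real_normK ?num_real// -[leRHS]real_normK ?num_real//.
by rewrite lerXn2r ?nnegrE// normrM (ger0_norm c0).
Qed.

Lemma cw_second_moment_contraction beta h m : 0 < beta < 1 -> m = mean_field beta h m ->
  exists K, forall N, (0 < N)%N -> cw_second_moment N beta h m <= K * N%:R.
Proof.
move=> /andP[b0 b1] mE.
exists ((16 * (beta + 1) + 18 * beta ^+ 2) / (1 - beta) ^+ 2) => N N0.
have c0 : 0 < (1 - beta) ^+ 2 by rewrite exprn_gt0// subr_gt0.
rewrite mulrAC ler_pdivlMr//.
apply: le_trans (cw_gap_moment h b0 N0); rewrite mulr_suml; apply: ler_sum => l _.
rewrite -mulrA ler_wpM2l ?cw_count_ge0//.
have := mean_field_gap_contraction (mean_spin N l) b0 mE.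
set z := mean_spin N l; move=> H.
by apply: sqr_scaled_le => //; rewrite subr_ge0 ltW.
Qed.

(** For nonnegative mean spin the gap z - mean_field z controls z - m. For
negative mean spin it need not, as there may be metastable solutions. Flipping
all the spins maps this region to the positive one, and a configuration with mean
spin - z < 0 is less likely than its mirror image by a factor exp (- 2 h N z).
This is exponentially small unless z is close to 0, hence far from m, which the
bound on the positive side already makes unlikely. *)
Lemma cw_second_moment_pos beta h m : 0 < beta -> 0 < h -> 0 < m -> m < 1 ->
  m = mean_field beta h m ->
  exists K, forall N, (0 < N)%N -> cw_second_moment N beta h m <= K * N%:R.
Proof.
move=> b0 h0 m0 m1 mE.
have th0 : 0 < tanh h by rewrite -tanh0 ltr_tanh.
pose c := tanh h / m; have c0 : 0 < c by rewrite divr_gt0.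
pose G := (16 * (beta + 1) + 18 * beta ^+ 2) / c ^+ 2.
exists (G + (4 / (h * m) + 16 / m ^+ 2 * G)) => N N0.
have n0 : 0 < N%:R :> R by rewrite ltr0n.
pose z (l : nat) : R := mean_spin N l.
pose u l : R := (N%:R * (z l - m)) ^+ 2.
have u0 l : 0 <= u l by exact: sqr_ge0.
have upper : \sum_(l < N.+1 | 0 <= z l) cw_count N beta h l * u l <= G * N%:R.
  rewrite mulrAC ler_pdivlMr ?exprn_gt0//.
  apply: le_trans (cw_gap_moment h b0 N0).
  rewrite big_mkcond mulr_suml; apply: ler_sum => l _.
  case: ifPn => [z0|_]; last first.
    by rewrite mul0r mulr_ge0 ?cw_count_ge0// sqr_ge0.
  rewrite -mulrA ler_wpM2l ?cw_count_ge0//.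
  have := mean_field_gap_pos b0 h0 m0 mE z0; rewrite -/c => H.
  exact: (sqr_scaled_le _ (ltW c0)).
rewrite /cw_second_moment (bigID (fun l : 'I_N.+1 => 0 <= z l))/= mulrDl lerD//.
have znat l : N%:R * z l = 2 * l%:R - N%:R.
  by rewrite /z /mean_spin; field; rewrite gt_eqF.
have zrev l : (l <= N)%N -> z (N - l)%N = - z l.
  by move=> lN; rewrite /z /mean_spin natrB//; field; rewrite gt_eqF.
have z1 l : (l <= N)%N -> z l <= 1.
  move=> lN; rewrite /z /mean_spin ler_pdivrMr// mul1r.
  have : l%:R <= N%:R :> R by rewrite ler_nat.
  lra.
(* If x < m/2, then (x - m)^2 is at least m^2/4 and the second term suffices;
   otherwise the exponential is at most 1 / (h m N). *)
have tail x : 0 < x -> expR (- (2 * h * (N%:R * x))) * (4 * N%:R ^+ 2) <=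
    4 * N%:R / (h * m) + 16 / m ^+ 2 * (N%:R * (x - m)) ^+ 2.
  move=> x0; have [xm|mx] := ltP x (m / 2).
    have H1 : (m / 2) ^+ 2 <= (x - m) ^+ 2 by nra.
    have e1 : expR (- (2 * h * (N%:R * x))) <= 1.
      by rewrite expR_le1 oppr_le0 !mulr_ge0// ltW.
    have H2 : 4 * N%:R ^+ 2 <= 16 / m ^+ 2 * (N%:R * (x - m)) ^+ 2.
      have -> : 16 / m ^+ 2 * (N%:R * (x - m)) ^+ 2 =
          (16 * N%:R ^+ 2 * (x - m) ^+ 2) / m ^+ 2.
        by ring.
      rewrite ler_pdivlMr ?exprn_gt0//.
      have n2 : 0 <= 16 * N%:R ^+ 2 :> R by rewrite mulr_ge0// sqr_ge0.
      have := ler_wpM2l n2 H1; lra.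
    have H3 : 0 <= 4 * N%:R / (h * m) by rewrite divr_ge0 ?mulr_ge0 ?ltW.
    have H4 : expR (- (2 * h * (N%:R * x))) * (4 * N%:R ^+ 2) <= 4 * N%:R ^+ 2.
      by rewrite ler_piMl// mulr_ge0// sqr_ge0.
    lra.
  have y0 : 0 < h * m * N%:R by rewrite !mulr_gt0.
  have H1 : expR (- (2 * h * (N%:R * x))) <= (h * m * N%:R)^-1.
    rewrite expRN lef_pV2 ?posrE ?expR_gt0//.
    apply: (@le_trans _ _ (1 + 2 * h * (N%:R * x))); last exact: expR_ge1Dx.
    have := ler_wpM2l (ltW (mulr_gt0 h0 n0)) mx; lra.
  have n2 : 0 <= 4 * N%:R ^+ 2 :> R by rewrite mulr_ge0// sqr_ge0.
  apply: (le_trans (ler_wpM2r n2 H1)).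
  rewrite (_ : (h * m * N%:R)^-1 * (4 * N%:R ^+ 2) = 4 * N%:R / (h * m)); last first.
    by field; rewrite !gt_eqF.
  by rewrite lerDl mulr_ge0 ?sqr_ge0// divr_ge0// sqr_ge0.
have -> : \sum_(l < N.+1 | ~~ (0 <= z l)) cw_count N beta h l * u l =
    \sum_(l < N.+1 | 0 < z l) cw_count N beta h (N - l) * u (N - l)%N.
  rewrite [LHS]big_mkcond [RHS]big_mkcond/=.
  rewrite [LHS](sum_rev N (fun l => if ~~ (0 <= z l) then cw_count N beta h l * u l else 0)).
  apply: eq_bigr => l _.
  have lN : (l <= N)%N by rewrite -ltnS.
  by rewrite (zrev l lN) oppr_ge0 -ltNge.
apply: (@le_trans _ _ (\sum_(l < N.+1 | 0 < z l) (4 * N%:R / (h * m) *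
    cw_count N beta h l + 16 / m ^+ 2 * (cw_count N beta h l * u l)))).
  apply: ler_sum => l zl; have lN : (l <= N)%N by rewrite -ltnS.
  rewrite (cw_count_flip beta h lN) -znat -mulrA.
  have p0 := cw_count_ge0 N beta h l.
  have uM : u (N - l)%N <= 4 * N%:R ^+ 2.
    rewrite /u (zrev l lN) exprMn [leRHS]mulrC ler_wpM2l ?sqr_ge0//.
    have := z1 l lN; move: (z l) zl => x x0 x1; nra.
  have e0 := expR_ge0 (- (2 * h * (N%:R * z l))).
  have H := le_trans (ler_wpM2l e0 uM) (tail (z l) zl).
  by have := ler_wpM2l p0 H; rewrite /u; lra.
rewrite big_split/= -!mulr_sumr.
have S1 : \sum_(l < N.+1 | 0 < z l) cw_count N beta h l <= 1.
  rewrite -(sum_cw_count N beta h) [leRHS](bigID (fun l : 'I_N.+1 => 0 < z l))/=.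
  by rewrite lerDl sumr_ge0// => l _; exact: cw_count_ge0.
have S2 : \sum_(l < N.+1 | 0 < z l) cw_count N beta h l * u l <= G * N%:R.
  apply: le_trans upper; rewrite big_mkcond [leRHS]big_mkcond/=.
  apply: ler_sum => l _; case: ltgtP => // _.
  by rewrite mulr_ge0 ?cw_count_ge0.
have q1 : 0 <= 4 * N%:R / (h * m) by rewrite divr_ge0 ?mulr_ge0 ?ltW.
have q2 : 0 <= 16 / m ^+ 2 by rewrite divr_ge0// sqr_ge0.
have := ler_wpM2l q1 S1; have := ler_wpM2l q2 S2; lra.
Qed.

Lemma cw_second_moment_reflect (N : nat) beta h m : (0 < N)%N ->
  cw_second_moment N beta (- h) (- m) = cw_second_moment N beta h m.
Proof.
move=> N0; have n0 : 0 < N%:R :> R by rewrite ltr0n.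
rewrite /cw_second_moment.
rewrite [RHS](sum_rev N (fun l => cw_count N beta h l * (N%:R * (mean_spin N l - m)) ^+ 2)).
apply: eq_bigr => l _; have lN : (l <= N)%N by rewrite -ltnS.
rewrite (cw_count_reflect beta h lN); congr (_ * _).
by rewrite /mean_spin natrB//; field; rewrite gt_eqF.
Qed.

End curie_weiss_concentration.

(** * Comparing two laws whose ratio is almost constant *)

Section comparison.
Context {R : realType}.

(** On the window [W] that carries almost all the mass of both laws, [p] is
almost proportional to [q]; as both masses are close to 1, the factor [c] is
close to 1 as well. The normalizing constants never have to be computed. *)
Lemma l1_comparison (I : finType) (p q : I -> R) (W : pred I) (c eta delta : R) :
  (forall i, 0 <= p i) -> (forall i, 0 <= q i) ->
  \sum_i p i = 1 -> \sum_i q i = 1 ->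
  \sum_(i | ~~ W i) p i <= delta -> \sum_(i | ~~ W i) q i <= delta ->
  0 <= c -> 0 <= eta <= 2^-1 ->
  (forall i, W i -> `|p i - c * q i| <= eta * (c * q i)) ->
  \sum_i `|p i - q i| <= 4 * eta + 3 * delta.
Proof.
move=> p0 q0 p1 q1 pd qd c0 /andP[e0 e1] H.
pose pW := \sum_(i | W i) p i; pose qW := \sum_(i | W i) q i.
have pWE : pW + \sum_(i | ~~ W i) p i = 1 by rewrite -p1 [RHS](bigID W).
have qWE : qW + \sum_(i | ~~ W i) q i = 1 by rewrite -q1 [RHS](bigID W).
have pC0 : 0 <= \sum_(i | ~~ W i) p i by apply: sumr_ge0 => i _; exact: p0.
have qC0 : 0 <= \sum_(i | ~~ W i) q i by apply: sumr_ge0 => i _; exact: q0.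
have qW0 : 0 <= qW by apply: sumr_ge0 => i _; exact: q0.
have HW : \sum_(i | W i) `|p i - c * q i| <= eta * (c * qW).
  by rewrite /qW !mulr_sumr; apply: ler_sum => i /H.
have pcq : `|pW - c * qW| <= eta * (c * qW).
  by apply: le_trans HW; rewrite /qW mulr_sumr -sumrB; exact: ler_norm_sum.
have cq0 : 0 <= c * qW by rewrite mulr_ge0.
have cq2 : c * qW <= 2.
  move: pcq => /ler_normlP[pcq _].
  have := ler_wpM2r cq0 e1; lra.
have eq2 : eta * (c * qW) <= 2 * eta by rewrite mulrC ler_wpM2r.
have c1 : `|c - 1| * qW <= eta * (c * qW) + delta.
  rewrite -{1}(ger0_norm qW0) -normrM mulrBl mul1r.
  move: pcq => /ler_normlP[h1 h2]; apply/ler_normlP; split; lra.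
rewrite (bigID W)/=.
have HC : \sum_(i | ~~ W i) `|p i - q i| <= delta + delta.
  apply: (@le_trans _ _ (\sum_(i | ~~ W i) (p i + q i))).
    apply: ler_sum => i _; apply: (le_trans (ler_normB _ _)).
    by rewrite !ger0_norm.
  by rewrite big_split/= lerD.
have HW' : \sum_(i | W i) `|p i - q i| <= eta * (c * qW) + `|c - 1| * qW.
  apply: (@le_trans _ _ (\sum_(i | W i) (`|p i - c * q i| + `|c - 1| * q i))).
    apply: ler_sum => i _; rewrite -{3}(ger0_norm (q0 i)) -normrM.
    rewrite [X in `|X|](_ : _ = (p i - c * q i) + (c - 1) * q i); last by ring.
    exact: ler_normD.
  by rewrite big_split/= -mulr_sumr lerD2r.
lra.
Qed.

Lemma ln1D_quadratic (t : R) : `|t| <= 2^-1 ->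
  exists2 r, `|r| <= 2 * t ^+ 2 & 1 + t = expR (t + r).
Proof.
move=> /ler_normlP[t1 t2]; have t0 : 0 < 1 + t by lra.
exists (ln (1 + t) - t); last by rewrite [t + _]addrC subrK lnK// posrE.
have H1 : ln (1 + t) <= t by apply: le_ln1Dx; lra.
have H2 : ln (1 + t)^-1 <= (1 + t)^-1 - 1.
  rewrite -[X in ln X](subrK 1) addrC; apply: le_ln1Dx.
  by rewrite ltrBrDr addNr invr_gt0.
move: H2; rewrite lnV ?posrE// => H2.
have H3 : t - 2 * t ^+ 2 <= 1 - (1 + t)^-1.
  have -> : 1 - (1 + t)^-1 = t / (1 + t) by field; rewrite gt_eqF.
  by rewrite ler_pdivlMr//; have := sqr_ge0 t; nra.
apply/ler_normlP; split; nra.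
Qed.

Lemma normr_expR_sub1 (t : R) : `|t| <= 2^-1 -> `|expR t - 1| <= 2 * `|t|.
Proof.
move=> t2; have := expR_ge1Dx t; have := expR_ge1Dx (- t).
have e0 := expR_gt0 t; rewrite expRN => H1 H2.
have H3 : expR t * (1 - t) <= 1.
  by have := ler_wpM2l (ltW e0) H1; rewrite divff ?gt_eqF.
move: t2 H1 H2 H3; move: (expR t) => e.
case: (ger0P t) => t0 t2 _ H2 H3.
  by rewrite ger0_norm ?subr_ge0; nra.
by apply/ler_normlP; split; nra.
Qed.

Lemma ratio_close (pi qi pj qj e tau : R) : 0 < pi -> 0 < qi -> 0 < qj ->
  pj * qi = pi * qj * expR e -> `|e| <= tau -> tau <= 2^-1 ->
  `|pj - pi / qi * qj| <= 2 * tau * (pi / qi * qj).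
Proof.
move=> pi0 qi0 qj0 E et t2.
have -> : pj = pi / qi * qj * expR e.
  by apply: (mulIf (lt0r_neq0 qi0)); rewrite E; field; rewrite gt_eqF.
have c0 : 0 < pi / qi * qj by rewrite mulr_gt0// divr_gt0.
rewrite -[X in _ - X]mulr1 -mulrBr normrM mulrC (gtr0_norm c0) ler_pM2r//.
by apply: (le_trans (normr_expR_sub1 (le_trans et t2))); rewrite ler_pM2l.
Qed.

(** Multiplicative errors along [n] unit steps add up in the exponent. The
quotients are cleared so that the statement is about products only. *)
Lemma window_ratio (p q : nat -> R) (i n : nat) (eta : R) :
  (forall l, (i <= l < i + n)%N -> 0 < p l /\ 0 < q l) ->
  (forall l, (i <= l < i + n)%N ->
     exists2 e, `|e| <= eta & p l.+1 * q l = p l * q l.+1 * expR e) ->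
  exists2 e, `|e| <= n%:R * eta & p (i + n)%N * q i = p i * q (i + n)%N * expR e.
Proof.
elim: n => [|n IHn] pq step.
  by exists 0; rewrite ?normr0 ?mul0r// addn0 expR0 mulr1.
have sub l : (i <= l < i + n)%N -> (i <= l < i + n.+1)%N.
  by move=> /andP[-> /= ln]; rewrite addnS ltnS ltnW.
have [l /sub/pq//|l /sub/step//|e1 e1n E1] := IHn.
have inn : (i <= i + n < i + n.+1)%N by rewrite leq_addr addnS /=.
have [e2 e2n E2] := step _ inn; have [pn qn] := pq _ inn.
exists (e1 + e2).
  by rewrite (le_trans (ler_normD _ _))// -natr1 mulrDl mul1r lerD.
apply: (mulIf (lt0r_neq0 pn)); apply: (mulIf (lt0r_neq0 qn)).
rewrite addnS expRD.
transitivity ((p (i + n).+1 * q (i + n)%N) * (p (i + n)%N * q i)); first by ring.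
by rewrite E1 E2; ring.
Qed.

End comparison.

(** * Local comparison of the two laws *)

Section local_comparison.
Context {R : realType}.

(** Either beta < 1 and the mean-field map contracts, or h is nonzero. The case
h < 0 follows from h > 0 by reflecting all the spins. *)
Lemma magnetization_regime (beta h : R) : 0 < beta -> h != 0 \/ beta < 1 ->
  let m := magnetization beta h in
  [/\ m = mean_field beta h m, beta * (1 - m ^+ 2) < 1 &
      exists K, forall N, (0 < N)%N -> cw_second_moment N beta h m <= K * N%:R].
Proof.
move=> b0 reg m.
have [b1|b1] := ltP beta 1.
  have mE := magnetization_contraction h (introT andP (conj b0 b1)).
  split=> //; last by apply: cw_second_moment_contraction => //; rewrite b0.
  have := sqr_ge0 m; nra.
have h0 : h != 0 by case: reg => // b1'; move: b1'; rewrite ltNge b1.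
have pos h' : 0 < h' -> let m' := magnetization beta h' in
  [/\ m' = mean_field beta h' m', beta * (1 - m' ^+ 2) < 1 &
      exists K, forall N, (0 < N)%N -> cw_second_moment N beta h' m' <= K * N%:R].
  move=> h'0 m'; have [m'0 m'E] := magnetization_pos b0 h'0.
  split=> //; first exact: (mean_field_slope_lt1 b0 h'0).
  by apply: cw_second_moment_pos => //; rewrite /m' [ltLHS]m'E tanh_lt1.
move: h0; rewrite neq_lt => /orP[h0|]; last exact: pos.
have nh0 : 0 < - h by rewrite oppr_gt0.
have [mE sl [K HK]] := pos _ nh0.
have mN : m = - magnetization beta (- h).
  by rewrite -(magnetizationN b0 nh0) opprK.
split.
- by rewrite mN {1}mE -mean_fieldN opprK.
- by rewrite mN sqrrN.
- exists K => N N0; rewrite mN.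
  have := cw_second_moment_reflect beta (- h) (magnetization beta (- h)) N0.
  by rewrite opprK => ->; exact: HK.
Qed.

(* The comparison rests on three facts about m: it solves the mean-field
   equation, the mean-field map has slope less than 1 at m, and the Curie-Weiss
   law concentrates around m. *)
Section one_regime.
Variables (beta h m : R).
Hypotheses (b0 : 0 < beta) (mE : m = mean_field beta h m).
Hypothesis slope1 : beta * (1 - m ^+ 2) < 1.

(** [gamma1] and [gamma2] at a given solution [m], which makes the dependence on
[magnetization] explicit. *)
Definition beta_rate1 : R := (1 - beta * (1 - m ^+ 2)) / (2 * beta * (1 - m)).
Definition beta_rate2 : R := (1 - beta * (1 - m ^+ 2)) / (2 * beta * (1 + m)).
Local Notation g1 := beta_rate1.
Local Notation g2 := beta_rate2.

Let m1 : 0 < 1 - m.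
Proof. by rewrite subr_gt0 mE tanh_lt1. Qed.

Let m2 : 0 < 1 + m.
Proof. by rewrite -ltrBlDl sub0r mE tanh_gtN1. Qed.

Lemma beta_rate1_gt0 : 0 < g1.
Proof. by rewrite divr_gt0 ?subr_gt0// !mulr_gt0. Qed.

Lemma beta_rate2_gt0 : 0 < g2.
Proof. by rewrite divr_gt0 ?subr_gt0// !mulr_gt0. Qed.

Let expR_m : (1 - m) * expR (2 * (beta * m + h)) = 1 + m.
Proof.
have := tanh_logistic (beta * m + h); rewrite -[tanh _]mE.
rewrite expRN; set e := expR _ => E.
have e0 : 0 < e by exact: expR_gt0.
have E2 : 2 * e = (1 + m) * (1 + e).
  have -> : 1 + m = 2 * (1 + e^-1)^-1 by rewrite E; field.
  by field; rewrite !gt_eqF ?addr_gt0.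
lra.
Qed.

(** The heart of the comparison. Let l / N = (1 + m) / 2 + y. The ratios of
consecutive weights of the two laws share the factor (N - l) / (l + 1), and what
remains differs by exp e, where e is a function of y up to errors of order 1/N.
This function vanishes at y = 0 because m solves the mean-field equation, and
its derivative vanishes there too: this is what the choice of gamma1 and gamma2
achieves, and it amounts to equality of the variances of the two Gaussian limits.
Hence e = O(y^2 + 1/N). *)
Lemma cw_bb_step (N l : nat) : (l < N)%N ->
  1 < g1 * N%:R -> 1 < g2 * N%:R ->
  let p := cw_count N beta h in
  let q := bb_count N (g1 * N%:R) (g2 * N%:R) in
  let y := (2 * l%:R - N%:R - N%:R * m) / (2 * N%:R) in
  4 * beta * (`|y| + N%:R^-1) <= 2^-1 ->
  exists2 e, `|e| <= (2 * beta + 96 * beta ^+ 2) * (y ^+ 2 + N%:R^-1) &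
    p l.+1 * q l = p l * q l.+1 * expR e.
Proof.
move=> lN a1 a2 p q y small.
have n0 : 0 < N%:R :> R by rewrite ltr0n (leq_trans _ lN).
(* With these t and s the two denominators are constants times N (1 + t) and
   N (1 - s), and t + s = 4 beta y up to order 1/N, which cancels the linear
   part of the drift. *)
pose t := 2 * beta * (1 - m) * y.
pose s := 2 * beta * (1 + m) * (y + N%:R^-1).
have ni0 : 0 < N%:R^-1 :> R by rewrite invr_gt0.
have ni1 : N%:R^-1 <= 1 :> R by rewrite invf_le1// ler1n (leq_trans _ lN).
have ts : `|t| <= 4 * beta * `|y|.
  rewrite /t normrM ler_wpM2r// gtr0_norm ?mulr_gt0//.
  by have := mulr_gt0 b0 m2; lra.
have ss : `|s| <= 4 * beta * (`|y| + N%:R^-1).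
  rewrite /s normrM; apply: ler_pM => //.
    by rewrite gtr0_norm ?mulr_gt0//; have := mulr_gt0 b0 m1; lra.
  by rewrite (le_trans (ler_normD _ _))// (gtr0_norm ni0).
have t2 : `|t| <= 2^-1.
  apply: (le_trans ts); apply: le_trans small.
  by rewrite ler_wpM2l ?mulr_ge0 ?(ltW b0)// lerDl ltW.
have s2 : `|- s| <= 2^-1 by rewrite normrN (le_trans ss).
have [r1 r1b r1E] := ln1D_quadratic t2.
have [r2 r2b r2E] := ln1D_quadratic s2.
exists (- (2 * beta * m / N%:R) + r2 - r1).
  have mN : `|2 * beta * m / N%:R| <= 2 * beta * N%:R^-1.
    rewrite normrM (gtr0_norm ni0) ler_wpM2r ?(ltW ni0)//.
    rewrite normrM (gtr0_norm (mulr_gt0 _ b0))// ler_piMr ?mulr_ge0 ?(ltW b0)//.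
    by apply/ler_normlP; split; move: m1 m2; lra.
  have tt : t ^+ 2 <= 16 * beta ^+ 2 * y ^+ 2.
    have -> : 16 * beta ^+ 2 * y ^+ 2 = (4 * beta * `|y|) ^+ 2.
      by rewrite -[y ^+ 2]real_normK ?num_real//; ring.
    rewrite -[leLHS]real_normK ?num_real// lerXn2r// nnegrE//.
    by rewrite !mulr_ge0// ltW.
  have sq : s ^+ 2 <= 32 * beta ^+ 2 * (y ^+ 2 + N%:R^-1).
    apply: (@le_trans _ _ ((4 * beta * (`|y| + N%:R^-1)) ^+ 2)).
      rewrite -[leLHS]real_normK ?num_real// lerXn2r// nnegrE//.
      by rewrite !mulr_ge0 ?addr_ge0// ltW.
    have -> : (4 * beta * (`|y| + N%:R^-1)) ^+ 2 =
        16 * beta ^+ 2 * (`|y| + N%:R^-1) ^+ 2 by ring.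
    have bb : 0 <= 16 * beta ^+ 2 by rewrite mulr_ge0// sqr_ge0.
    have : (`|y| + N%:R^-1) ^+ 2 <= 2 * (y ^+ 2 + N%:R^-1).
      have -> : y ^+ 2 = `|y| ^+ 2 by rewrite real_normK ?num_real.
      have := sqr_ge0 (`|y| - N%:R^-1).
      have := ler_wpM2l (ltW ni0) ni1; lra.
    by move/(ler_wpM2l bb); lra.
  have nb : 0 <= beta ^+ 2 * N%:R^-1 by rewrite mulr_ge0 ?sqr_ge0// ltW.
  have yb : 0 <= beta * y ^+ 2 by rewrite mulr_ge0 ?sqr_ge0// ltW.
  move: mN r1b r2b => /ler_normlP[mN1 mN2] /ler_normlP[r11 r12] /ler_normlP[r21 r22].
  rewrite sqrrN in r21 r22.
  by apply/ler_normlP; split; lra.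
have denA : l%:R + g1 * N%:R = N%:R * (1 + t) / (2 * beta * (1 - m)).
  rewrite /t /y /beta_rate1; field.
  by rewrite !gt_eqF ?mulr_gt0.
have denB : N%:R - l.+1%:R + g2 * N%:R = N%:R * (1 - s) / (2 * beta * (1 + m)).
  rewrite /s /y /beta_rate2 -natr1; field.
  by rewrite !gt_eqF ?mulr_gt0.
have drift : expR (cw_drift N beta h l%:R) =
    expR (2 * (beta * m + h)) * expR (4 * beta * y + 2 * beta / N%:R).
  rewrite -expRD /cw_drift /y; congr expR; field; exact: lt0r_neq0.
have P := cw_count_rec beta h lN.
have Q := bb_count_rec a1 a2 lN.
have nl : 0 < N%:R - l%:R :> R by rewrite subr_gt0 ltr_nat.
have D : p l.+1 * q l * (1 + t) = p l * q l.+1 * ((1 - s) *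
    expR (4 * beta * y + 2 * beta / N%:R)).
  have cst : 0 < l.+1%:R * (N%:R - l%:R) * N%:R * (1 + m).
    by rewrite !mulr_gt0.
  apply: (mulIf (lt0r_neq0 cst)).
  transitivity ((p l.+1 * l.+1%:R) * (q l * ((N%:R - l%:R) * (l%:R + g1 * N%:R)))
     * (2 * beta * (1 - m) * (1 + m))).
    by rewrite denA; field; rewrite !gt_eqF ?mulr_gt0.
  rewrite /p /q -P Q denB drift -[in RHS]expR_m.
  by field; rewrite !gt_eqF ?mulr_gt0.
rewrite r1E r2E -expRD in D.
have e0 := expR_gt0 (t + r1).
apply: (mulIf (lt0r_neq0 e0)); rewrite D -[RHS]mulrA -!expRD.
by congr (_ * expR _); rewrite /t /s; ring.
Qed.

(** The zero of the beta-binomial drift is the same centre N (1 + m) / 2. *)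
Lemma bb_second_moment_at_rates (N : nat) : (0 < N)%N -> 1 < g1 * N%:R -> 1 < g2 * N%:R ->
  \sum_(l < N.+1) bb_count N (g1 * N%:R) (g2 * N%:R) l *
    (N%:R * (mean_spin N l - m)) ^+ 2 <= 4 * (1 + g1) / (g1 + g2) * N%:R.
Proof.
move=> N0 a1 a2; have n0 : 0 < N%:R :> R by rewrite ltr0n.
have G0 : 0 < g1 + g2 by rewrite addr_gt0 ?beta_rate1_gt0 ?beta_rate2_gt0.
have := bb_second_moment N a1 a2.
have E (l : nat) : (N%:R * (g1 * N%:R) - l%:R * (g1 * N%:R + g2 * N%:R)) ^+ 2 =
    (N%:R * (mean_spin N l - m)) ^+ 2 * (N%:R * (g1 + g2) / 2) ^+ 2.
  rewrite -exprMn /mean_spin /beta_rate1 /beta_rate2 -sqrrN; congr (_ ^+ 2).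
  by field; rewrite !gt_eqF ?mulr_gt0.
under eq_bigr do rewrite E mulrA.
rewrite -mulr_suml; set S := \sum_(l < _) _ => H.
have c0 : 0 < (N%:R * (g1 + g2) / 2) ^+ 2 by rewrite exprn_gt0// !mulr_gt0.
rewrite -(ler_pM2r c0); apply: (le_trans H).
rewrite le_eqVlt; apply/orP; left; apply/eqP; field.
by rewrite gt_eqF.
Qed.

Lemma chebyshev_sum (I : finType) (p v : I -> R) (w : R) :
  (forall i, 0 <= p i) -> 0 < w ->
  \sum_(i | ~~ (`|v i| <= w)) p i <= (\sum_i p i * v i ^+ 2) / w ^+ 2.
Proof.
move=> p0 w0; rewrite ler_pdivlMr ?exprn_gt0// mulr_suml big_mkcond/=.
apply: ler_sum => i _; case: ifPn => [|_]; last first.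
  by rewrite mulr_ge0// sqr_ge0.
rewrite -ltNge => wv; rewrite ler_wpM2l// -[leRHS]real_normK ?num_real//.
by rewrite lerXn2r ?nnegrE ?(ltW w0)// ltW.
Qed.

(* In the next three bounds x stands for r and n for N, where n >= x^5: the window
   has half-width r^3, so that relative deviations are y = O(r^3 / N), each of the
   O(r^3) steps costs O(y^2 + 1/N) = O(r / N), and the total is O(1 / r). *)
Let window_small (x n y : R) : 1 <= x -> x ^+ 5 <= n -> 16 * beta <= x ->
  `|y| <= x ^+ 3 / n -> 4 * beta * (`|y| + n^-1) <= 2^-1.
Proof.
move=> x1 xn xb yb; have x0 : 0 < x by lra.
have n0 : 0 < n by apply: lt_le_trans xn; rewrite exprn_gt0.
apply: (@le_trans _ _ (4 * beta * ((x ^+ 3 + 1) / n))).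
  by rewrite ler_wpM2l ?mulr_ge0 ?(ltW b0)// mulrDl mul1r lerD2r.
rewrite mulrA ler_pdivrMr//.
have x3 : 1 <= x ^+ 3 by rewrite exprn_ege1.
have bx : 4 * beta * (x ^+ 3 + 1) <= 8 * beta * x ^+ 3.
  have := ler_wpM2l (ltW b0) x3; lra.
have xx : 16 * beta * x ^+ 3 <= x ^+ 4.
  by rewrite (exprS x 3) ler_wpM2r// exprn_ge0// ltW.
have x4 : x ^+ 4 <= x ^+ 5 by rewrite (exprS x 4) ler_peMl// exprn_ge0// ltW.
lra.
Qed.

Let window_square (x n y : R) : 1 <= x -> x ^+ 5 <= n ->
  `|y| <= x ^+ 3 / n -> y ^+ 2 + n^-1 <= 2 * x / n.
Proof.
move=> x1 xn yb; have x0 : 0 < x by lra.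
have n0 : 0 < n by apply: lt_le_trans xn; rewrite exprn_gt0.
have y2 : y ^+ 2 <= x / n.
  apply: (@le_trans _ _ ((x ^+ 3 / n) ^+ 2)).
    by rewrite -[leLHS]real_normK ?num_real// lerXn2r ?nnegrE// (le_trans _ yb).
  have -> : (x ^+ 3 / n) ^+ 2 = x ^+ 5 * x / n / n by field; rewrite gt_eqF.
  by rewrite ler_pM2r ?invr_gt0// ler_pdivrMr// [leRHS]mulrC ler_wpM2r// ltW.
have : n^-1 <= x / n by rewrite ler_peMl// invr_ge0 ltW.
lra.
Qed.

Let window_total (x n K d : R) : 1 <= x -> x ^+ 5 <= n -> 0 <= K ->
  d <= 2 * x ^+ 3 -> d * (K * (2 * x / n)) <= 4 * K / x.
Proof.
move=> x1 xn K0 dx; have x0 : 0 < x by lra.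
have n0 : 0 < n by apply: lt_le_trans xn; rewrite exprn_gt0.
have c0 : 0 <= K * (2 * x / n) by rewrite mulr_ge0// divr_ge0 ?mulr_ge0 ?ltW.
apply: (le_trans (ler_wpM2r c0 dx)); rewrite ler_pdivlMr//.
have -> : 2 * x ^+ 3 * (K * (2 * x / n)) * x = 4 * K * (x ^+ 5 / n).
  by field; rewrite gt_eqF.
by rewrite ler_piMr ?mulr_ge0// ler_pdivrMr// mul1r.
Qed.

(** The constant [c] is the ratio of the two laws at the left end of the window,
and the other points are reached from there by unit steps inside the window. *)
Lemma cw_bb_window (N r : nat) : (0 < r)%N -> (r ^ 5 <= N)%N ->
  1 < g1 * N%:R -> 1 < g2 * N%:R -> 16 * beta <= r%:R ->
  let p := cw_count N beta h in
  let q := bb_count N (g1 * N%:R) (g2 * N%:R) in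
  let K := 2 * beta + 96 * beta ^+ 2 in
  16 * K <= r%:R ->
  exists2 c, 0 <= c & forall l : 'I_N.+1,
    `|N%:R * (mean_spin N l - m)| <= 2 * r%:R ^+ 3 ->
    `|p l - c * q l| <= 8 * K / r%:R * (c * q l).
Proof.
move=> r0 rN a1 a2 rb p q K rK.
pose v (l : nat) : R := N%:R * (mean_spin N l - m).
have N0 : (0 < N)%N by apply: leq_trans rN; rewrite expn_gt0 r0.
have n0 : 0 < N%:R :> R by rewrite ltr0n.
have rr0 : 0 < r%:R :> R by rewrite ltr0n.
have rr1 : 1 <= r%:R :> R by rewrite ler1n.
have rrN : r%:R ^+ 5 <= N%:R :> R by rewrite -natrX ler_nat.
have K0 : 0 <= K by rewrite addr_ge0 ?mulr_ge0 ?sqr_ge0// ltW.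
have vE l : v l = 2 * l%:R - N%:R - N%:R * m.
  by rewrite /v /mean_spin; field; rewrite gt_eqF.
have vmono l l' : (l <= l')%N -> v l <= v l'.
  by move=> ll'; rewrite !vE; have : l%:R <= l'%:R :> R by [rewrite ler_nat]; lra.
pose W l := `|v l| <= 2 * r%:R ^+ 3.
have [[i0 i0P]|none] := pselect (exists l, (l <= N)%N && W l); last first.
  exists 0 => // l Wl; exfalso; apply: none; exists l.
  by rewrite -ltnS ltn_ord.
have [i /andP[iN Wi] imin] := ex_minnP (ex_intro (fun l => (l <= N)%N && W l) i0 i0P).
have pi0 : 0 < p i by exact: cw_count_gt0.
have qi0 : 0 < q i by exact: bb_count_gt0.
exists (p i / q i); first by rewrite divr_ge0 ?ltW.
move=> j Wj; have jN : (j <= N)%N by rewrite -ltnS.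
have ij : (i <= j)%N by apply: imin; rewrite jN.
pose eta := K * (2 * r%:R / N%:R).
have [||e eb E] := @window_ratio _ p q i (j - i) eta.
- move=> l; rewrite subnKC// => /andP[il lj]; have lN := leq_trans (ltnW lj) jN.
  by split; [exact: cw_count_gt0|exact: bb_count_gt0].
- move=> l; rewrite subnKC// => /andP[il lj]; have lN := leq_trans lj jN.
  have Wl : `|v l| <= 2 * r%:R ^+ 3.
    have := vmono _ _ il; have := vmono _ _ (ltnW lj).
    move: Wi Wj; rewrite /W -/(v j) => /ler_normlP[h1 h2] /ler_normlP[h3 h4] h5 h6.
    by apply/ler_normlP; split; lra.
  pose y := (2 * l%:R - N%:R - N%:R * m) / (2 * N%:R).
  have yb : `|y| <= r%:R ^+ 3 / N%:R.
    rewrite /y -vE normrM [`|_^-1|]gtr0_norm ?invr_gt0 ?mulr_gt0//.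
    rewrite ler_pdivrMr ?mulr_gt0// (le_trans Wl)// le_eqVlt; apply/orP; left.
    by apply/eqP; field; rewrite gt_eqF.
  have [|e eb E] := cw_bb_step lN a1 a2.
    by rewrite -/y; exact: window_small yb.
  exists e => //; apply: (le_trans eb); rewrite -/y ler_wpM2l//.
  exact: window_square yb.
move: E; rewrite subnKC// => E.
have qj0 : 0 < q j by exact: bb_count_gt0.
have ji : (j - i)%:R <= 2 * r%:R ^+ 3 :> R.
  rewrite natrB//; have -> : j%:R - i%:R = (v j - v i) / 2 :> R.
    by rewrite !vE; field.
  move: Wi Wj; rewrite /W -/(v j) => /ler_normlP[h1 h2] /ler_normlP[h3 h4].
  lra.
have tau : `|e| <= 4 * K / r%:R.
  by apply: (le_trans eb); exact: window_total.
have -> : 8 * K / r%:R = 2 * (4 * K / r%:R) by ring.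
by apply: ratio_close E tau _ => //; rewrite ler_pdivrMr//; move: rK; lra.
Qed.

End one_regime.
End local_comparison.

(** For N of the order of r^5 and a window of half-width r^3, the mass outside
the window is O(N / r^6) = O(1/r) by Chebyshev's inequality, and inside the window
the ratio of the laws varies by O(1/r). Any width between N^(1/2) and N^(2/3)
would do; the exponent 3/5 balances the two errors. *)
Lemma cw_bb_rate (R : realType) (beta h m K1 : R) (b0 : 0 < beta)
    (mE : m = mean_field beta h m) (slope1 : beta * (1 - m ^+ 2) < 1) :
  let g1 := beta_rate1 beta m in let g2 := beta_rate2 beta m in
  (forall N, (0 < N)%N -> cw_second_moment N beta h m <= K1 * N%:R) ->
  exists C r0 : R, forall r N, (0 < r)%N -> r0 <= r%:R -> (r ^ 5 <= N <= 32 * r ^ 5)%N ->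
    [/\ 1 < g1 * N%:R, 1 < g2 * N%:R &
     \sum_(l < N.+1) `|cw_count N beta h l -
                       bb_count N (g1 * N%:R) (g2 * N%:R) l| <= C / r%:R].
Proof.
move=> g1 g2 HK; pose K := 2 * beta + 96 * beta ^+ 2.
pose K2 := 4 * (1 + g1) / (g1 + g2).
have g10 : 0 < g1 := beta_rate1_gt0 b0 mE slope1.
have g20 : 0 < g2 := beta_rate2_gt0 b0 mE slope1.
have K0 : 0 <= K by rewrite addr_ge0 ?mulr_ge0 ?sqr_ge0// ltW.
have K20 : 0 <= K2 by rewrite divr_ge0 ?mulr_ge0 ?addr_ge0// ltW.
have K10 : 0 <= K1.
  have := HK 1%N isT; rewrite mulr1; apply: le_trans.
  by apply: sumr_ge0 => l _; rewrite mulr_ge0 ?cw_count_ge0// sqr_ge0.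
exists (32 * K + 24 * (K1 + K2)), (16 * beta + 16 * K + g1^-1 + g2^-1 + 1).
move=> r N r0 rbig /andP[rN Nr].
have gi1 : 0 < g1^-1 by rewrite invr_gt0.
have gi2 : 0 < g2^-1 by rewrite invr_gt0.
have rr0 : 0 < r%:R :> R by rewrite ltr0n.
have N0 : (0 < N)%N by apply: leq_trans rN; rewrite expn_gt0 r0.
have rrN : r%:R <= N%:R :> R.
  by rewrite ler_nat (leq_trans _ rN)// expnS leq_pmulr// expn_gt0 r0.
have rNR : N%:R <= 32 * r%:R ^+ 5 :> R by rewrite -natrX -natrM ler_nat.
have large (g : R) : 0 < g -> g^-1 < r%:R -> 1 < g * N%:R.
  by move=> g0 gr; rewrite -ltr_pdivrMl// mulr1 (lt_le_trans gr).
have a1 : 1 < g1 * N%:R by apply: large => //; lra.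
have a2 : 1 < g2 * N%:R by apply: large => //; lra.
split=> //.
have [||c c0 close] := cw_bb_window b0 mE r0 rN a1 a2; [lra|rewrite -/K; lra|].
have w0 : 0 < 2 * r%:R ^+ 3 :> R by rewrite mulr_gt0// exprn_gt0.
pose v (l : 'I_N.+1) : R := N%:R * (mean_spin N l - m).
have tail (p : 'I_N.+1 -> R) Kp : (forall l, 0 <= p l) -> 0 <= Kp ->
    \sum_l p l * v l ^+ 2 <= Kp * N%:R ->
    \sum_(l | ~~ (`|v l| <= 2 * r%:R ^+ 3)) p l <= 8 * Kp / r%:R.
  move=> p0 Kp0 H; apply: (le_trans (chebyshev_sum v p0 w0)).
  rewrite ler_pdivrMr ?exprn_gt0//; apply: (le_trans H).
  have -> : 8 * Kp / r%:R * (2 * r%:R ^+ 3) ^+ 2 = Kp * (32 * r%:R ^+ 5).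
    by field; rewrite gt_eqF.
  by rewrite ler_wpM2l.
have t1 := tail (fun l => cw_count N beta h l) K1 (fun l => cw_count_ge0 N beta h l)
  K10 (HK N N0).
have t2 := tail (fun l => bb_count N (g1 * N%:R) (g2 * N%:R) l) K2
  (fun l => bb_count_ge0 N _ _ l) K20 (bb_second_moment_at_rates b0 mE slope1 N0 a1 a2).
have -> : (32 * K + 24 * (K1 + K2)) / r%:R =
    4 * (8 * K / r%:R) + 3 * (8 * (K1 + K2) / r%:R) by ring.
apply: (@l1_comparison _ _ _ _ (fun l => `|v l| <= 2 * r%:R ^+ 3) c).
- by move=> l; exact: cw_count_ge0.
- by move=> l; exact: bb_count_ge0.
- exact: sum_cw_count.
- exact: sum_bb_count.
- apply: (le_trans t1); rewrite ler_wpM2r ?invr_ge0 ?(ltW rr0)//; lra.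
- apply: (le_trans t2); rewrite ler_wpM2r ?invr_ge0 ?(ltW rr0)//; lra.
- exact: c0.
- rewrite divr_ge0 ?mulr_ge0 ?(ltW rr0)//= ler_pdivrMr//; lra.
- exact: close.
Qed.


(** * Conclusion *)

Lemma fifth_root_between (N : nat) : (0 < N)%N ->
  exists2 r, (0 < r)%N & (r ^ 5 <= N <= 32 * r ^ 5)%N.
Proof.
move=> N0.
have ex : exists r, (r ^ 5 <= N)%N by exists 0%N.
have bd r : (r ^ 5 <= N)%N -> (r <= N)%N.
  case: r => // r; apply: leq_trans.
  by rewrite expnS leq_pmulr// expn_gt0.
have [r rN rmax] := ex_maxnP ex bd.
have r0 : (0 < r)%N by apply: rmax; rewrite exp1n.
exists r => //; rewrite rN/= -[32%N]/(2 ^ 5)%N -expnMn.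
have : (N < r.+1 ^ 5)%N by rewrite ltnNge; apply/negP => /rmax; rewrite ltnn.
move/ltnW/leq_trans; apply; rewrite leq_exp2r// mul2n -addnn.
by rewrite -add1n leq_add2r.
Qed.

Lemma cvge0_le (R : realType) (u : nat -> \bar R) :
  (forall n, 0 <= u n)%E ->
  (forall e : R, 0 < e -> \forall n \near \oo, (u n <= e%:E)%E) ->
  u n @[n --> \oo] --> 0%E.
Proof.
move=> u0 ule; apply/fine_cvgP; split.
  near=> n; rewrite ge0_fin_numE//; apply: (@le_lt_trans _ _ 1%:E); last exact: ltry.
  by near: n; exact: ule.
apply/cvgrPdist_le => e e0; near=> n.
have un : (u n <= e%:E)%E by near: n; exact: ule.
rewrite sub0r normrN ger0_norm; last exact: fine_ge0.
rewrite -lee_fin fineK// ge0_fin_numE//; exact: le_lt_trans (ltry e).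
Unshelve. all: by end_near. Qed.

Lemma dTV_ge0 (R : realType) (M1 M2 : {measure set R -> \bar R}) : (0 <= dTV M1 M2)%E.
Proof.
apply: (@le_trans _ _ `|M1 set0 - M2 set0|%E); first exact: abse_ge0.
by apply: ereal_sup_ubound; exists set0.
Qed.

Theorem theorem3p5 (R : realType) (beta h : R) (k : nat -> nat) (alpha : R)
    (beta_gt0 : 0 < beta) (uniq_regime : h != 0 \/ beta < 1)
    (k_bounds : forall N : nat, (0 < N)%N -> (0 < k N)%N /\ (k N <= N)%N)
    (k_cvg : k N @[N --> \oo] --> \oo)
    (alpha01 : 0 <= alpha <= 1)
    (k_ratio : (k N)%:R / N%:R @[N --> \oo] --> alpha) :
  dTV (distribution (curie_weiss N beta h) (@plus_count R N (k N)))
      (mixed_binomial (k N)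
         (rbeta_prob (gamma1 beta h * N%:R) (gamma2 beta h * N%:R)))
    @[N --> \oo] --> 0%E.
Proof.
have [mE slope1 [K1 HK]] := magnetization_regime beta_gt0 uniq_regime.
have [C [r0 rate]] := cw_bb_rate beta_gt0 mE slope1 HK.
apply: cvge0_le => [N|e e0]; first exact: dTV_ge0.
pose r1 := (Num.truncn (`|r0| + `|C / e|)).+1.
near=> N.
have N1 : (32 * r1 ^ 5 <= N)%N by near: N; exact: nbhs_infty_ge.
have N0 : (0 < N)%N by apply: leq_trans N1; rewrite muln_gt0 expn_gt0.
have [r rpos rN] := fifth_root_between N0.
have r1r : (r1 <= r)%N.
  rewrite -(leq_exp2r _ _ (isT : (0 < 5)%N)) -(leq_pmul2l (isT : (0 < 32)%N)).
  by apply: (leq_trans N1); case/andP: rN.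
have rbig : `|r0| + `|C / e| <= r%:R.
  by apply: le_trans (ltW (truncnS_gt _)) _; rewrite ler_nat.
have [|a1 a2 le] := rate r N rpos _ rN.
  by rewrite (le_trans (ler_norm _))// (le_trans _ rbig)// lerDl.
apply: (le_trans (dTV_le_counts beta h (k_bounds N N0).2 a1 a2)).
rewrite lee_fin (le_trans le)// ler_pdivrMr ?ltr0n// mulrC -ler_pdivrMr//.
by rewrite (le_trans (ler_norm _))// (le_trans _ rbig)// lerDr.
Unshelve. all: by end_near. Qed.
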